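(* Let $\theta\in[0,1]\setminus\mathbb Q$. Suppose there is a real $\kappa>0$ such that for every $n=0,1,\dots$ the sequence $[a_0,\dots,a_n]$ of partial quotients of $\theta$ is computable (as a finite list of binary integers, by a Turing machine on input $n$ in unary) in fewer than $2^{\kappa n}$ steps. Then the word problem of the Effros–Shen algebra $\mathfrak F_\theta$ has polynomial time complexity: there are a polynomial $T$ and a Turing machine deciding, for any two formulas $\phi,\psi$, in fewer than $T(\|\phi\|+\|\psi\|)$ steps whether $\phi$ and $\psi$ code the same element of $E(\mathfrak F_\theta)$.
   Context: Let $M_1$ be the unital $\ell$-group of continuous piecewise linear $f:[0,1]\to\mathbb R$ with finitely many linear pieces having integer coefficients (unit the constant $1$), and $\mathfrak M_1$ (the Farey AF algebra) the unital AF algebra whose unital ordered $K_0$-group is isomorphic to $(M_1,1)$. For an AF algebra $\mathfrak B$ whose Murray–von Neumann order of projections is a lattice, $E(\mathfrak B)$ is its Elliott involutive monoid: Murray–von Neumann classes of projections with the unique total extension $\oplus$ of Elliott's partial addition and involution $[p]^*=[1-p]$ (equivalently, the unit interval $[0,u]$ of $K_0(\mathfrak B)$ with $x^*=u-x$, $x\oplus y=(x+y)\wedge u$). $E(\mathfrak M_1)$ is the free one-generator MV-algebra; fix a projection $\mathsf p$ with $[\mathsf p]$ generating it. Ideals of $\mathfrak M_1$ correspond bijectively to ideals of $K_0(\mathfrak M_1)=M_1$. For irrational $\theta\in[0,1]$, the Effros–Shen algebra $\mathfrak F_\theta$ is the AF algebra with $K_0(\mathfrak F_\theta)\cong(\mathbb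 Z+\mathbb Z\theta,1)$ (ordered as a subgroup of $\mathbb R$); it equals $\mathfrak M_1/\mathfrak J_\theta$, where $\mathfrak J_\theta$ corresponds to $\{f\in M_1\mid f(\theta)=0\}$, and $E(\mathfrak F_\theta)$ is generated by $[\mathsf p/\mathfrak J_\theta]$. Formulas are strings over $\{0,X,{}^*,\oplus,(,)\}$: $0,X$ are formulas; if $\phi,\psi$ are, so are $\phi^*$ and $(\phi\oplus\psi)$. A formula codes the element of $E(\mathfrak F_\theta)$ obtained by interpreting $X$ as $[\mathsf p/\mathfrak J_\theta]$ and $0,{}^*,\oplus$ as the monoid operations. $\|\phi\|$ is the number of symbol occurrences in $\phi$. The partial quotients $a_0,a_1,\dots$ of $\theta$ are those of its regular continued fraction expansion. *)

(* Defs.v *)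
From Corelib Require Import BinNums.
From HB Require Import structures.
From mathcomp Require Import all_boot all_order all_algebra.
From mathcomp Require Import generic_quotient.
From mathcomp Require Import complex.
From mathcomp Require Import all_classical all_reals all_analysis.
From mathcomp Require Import ssrAC.

Set Implicit Arguments.
Unset Strict Implicit.
Unset Printing Implicit Defensive.

Import Order.TTheory GRing.Theory Num.Theory.
Import numFieldNormedType.Exports.

Local Open Scope quotient_scope.
Local Open Scope classical_set_scope.
Local Open Scope ring_scope.

(* Nonzero unital C*-algebras. The norm is a plain function, with its topology
   spelled out below, because the hierarchy admits no structure joining rings
   and normed modules below numDomainType. *)

HB.mixin Record isCStarAlgebra (R : realType) A of GRing.Algebra R[i] A := {
  star : A -> A;
  cnorm : A -> R;
  starK : involutive star;
  starD : {morph star : x y / x + y};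
  starZ : forall (a : R[i]) (x : A), star (a *: x) = conjc a *: star x;
  starM : forall x y : A, star (x * y) = star y * star x;
  cnormD : forall x y : A, cnorm (x + y) <= cnorm x + cnorm y;
  cnormZ : forall (a : R[i]) (x : A), cnorm (a *: x) = Normc.normc a * cnorm x;
  cnorm0_eq0 : forall x : A, cnorm x = 0 -> x = 0;
  cnormM : forall x y : A, cnorm (x * y) <= cnorm x * cnorm y;
  cnorm_cstar : forall x : A, cnorm (star x * x) = cnorm x ^+ 2;
  cnorm_complete : forall u : nat -> A,
    (forall e : R, 0 < e -> exists N : nat,
       forall m n : nat, (N <= m)%N -> (N <= n)%N -> cnorm (u m - u n) < e) ->
    exists l : A, forall e : R, 0 < e -> exists N : nat,
       forall n : nat, (N <= n)%N -> cnorm (u n - l) < e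
}.

#[short(type="cstarAlgType")]
HB.structure Definition CStarAlgebra (R : realType) :=
  {A of GRing.Algebra R[i] A & isCStarAlgebra R A}.

Section CStar.
Variables (R : realType) (A : cstarAlgType R).

Definition norm_closure (B : set A) : set A :=
  [set x | forall e : R, 0 < e -> exists2 y, B y & cnorm (x - y) < e].

Definition star_subalgebra (B : set A) : Prop :=
  [/\ B 1,
      forall x y, B x -> B y -> B (x + y),
      forall (a : R[i]) x, B x -> B (a *: x),
      forall x y, B x -> B y -> B (x * y) &
      forall x, B x -> B (star x)].

Definition finite_dimensional (B : set A) : Prop :=
  exists (n : nat) (b : 'I_n -> A),
    forall x, B x -> exists c : 'I_n -> R[i], x = \sum_i c i *: b i.

Definition AF_algebra : Prop :=
  exists B : nat -> set A,
    [/\ forall n, star_subalgebra (B n),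
        forall n, finite_dimensional (B n),
        forall n, B n `<=` B n.+1 &
        norm_closure (\bigcup_n B n) = setT].

Definition closed_ideal (J : set A) : Prop :=
  [/\ norm_closure J `<=` J, J 0,
      forall x y, J x -> J y -> J (x + y),
      forall x y, J y -> J (x * y) &
      forall x y, J y -> J (y * x)].

Definition adjmx m n (x : 'M[A]_(m, n)) : 'M[A]_(n, m) :=
  map_mx star x^T.

Definition projmx n (e : 'M[A]_n) : Prop := e *m e = e /\ adjmx e = e.

Record mproj := MProj { mdim : nat; mmx : 'M[A]_mdim; mprojP : projmx mmx }.

HB.instance Definition _ := gen_eqMixin mproj.
HB.instance Definition _ := gen_choiceMixin mproj.

Definition mvn_prop (p q : mproj) : Prop :=
  exists v : 'M[A]_(mdim p, mdim q),
    v *m adjmx v = mmx p /\ adjmx v *m v = mmx q.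

Definition mvn (p q : mproj) : bool := `[< mvn_prop p q >].

Lemma star0 : star (0 : A) = 0.
Proof. by apply: (addrI (star (0 : A))); rewrite -starD !addr0. Qed.

Lemma star1 : star (1 : A) = 1.
Proof. by have := starM 1 (star (1 : A)); rewrite mul1r starK mul1r. Qed.

Lemma adjmxK m n (x : 'M[A]_(m, n)) : adjmx (adjmx x) = x.
Proof. by apply/matrixP => i j; rewrite !mxE starK. Qed.

Lemma adjmxM m n k (x : 'M[A]_(m, n)) (y : 'M[A]_(n, k)) :
  adjmx (x *m y) = adjmx y *m adjmx x.
Proof.
apply/matrixP => i j; rewrite !mxE (big_morph _ starD star0).
by apply: eq_bigr => l _; rewrite !mxE starM.
Qed.

Lemma adjmx0 m n : adjmx (0 : 'M[A]_(m, n)) = 0.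
Proof. by apply/matrixP => i j; rewrite !mxE star0. Qed.

Lemma adjmx_block m n k l (a : 'M[A]_(m, k)) (b : 'M[A]_(m, l))
    (c : 'M[A]_(n, k)) (d : 'M[A]_(n, l)) :
  adjmx (block_mx a b c d) = block_mx (adjmx a) (adjmx c) (adjmx b) (adjmx d).
Proof. by rewrite /adjmx tr_block_mx map_block_mx. Qed.

Lemma mvn_refl : reflexive mvn.
Proof.
move=> [n e [ee es]]; apply/asboolP; exists e => /=.
by rewrite es.
Qed.

Lemma mvn_sym : symmetric mvn.
Proof.
have H p q : mvn p q -> mvn q p.
  move=> /asboolP[v [vp vq]]; apply/asboolP; exists (adjmx v).
  by rewrite adjmxK.
by move=> p q; apply/idP/idP; apply: H.
Qed.

Lemma mvn_trans : transitive mvn.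
Proof.
move=> q p r /asboolP[v [vp vq]] /asboolP[w [wq wr]]; apply/asboolP.
exists (v *m w); rewrite adjmxM; split.
  rewrite mulmxA -(mulmxA v) wq -vq mulmxA -mulmxA vp.
  by case: (mprojP p).
rewrite mulmxA -(mulmxA (adjmx w)) vq -wq mulmxA -mulmxA wr.
by case: (mprojP r).
Qed.

Canonical mvn_equiv := EquivRel mvn mvn_refl mvn_sym mvn_trans.

Lemma projmx_block (p q : mproj) :
  projmx (block_mx (mmx p) 0 0 (mmx q)).
Proof.
case: p q => [m e [ee es]] [n f [ff fs]] /=; split.
  by rewrite mulmx_block !mulmx0 !mul0mx !addr0 !add0r ee ff.
by rewrite adjmx_block !adjmx0 es fs.
Qed.

Definition dsum (p q : mproj) : mproj := MProj (projmx_block p q).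

Lemma projmx0 : projmx (0 : 'M[A]_0).
Proof. by split; rewrite ?mulmx0 // adjmx0. Qed.

Definition proj0 : mproj := MProj projmx0.

Lemma mvn_dsum p p' q q' : mvn p p' -> mvn q q' ->
  mvn (dsum p q) (dsum p' q').
Proof.
move=> /asboolP[v [vp vq]] /asboolP[w [wp wq]]; apply/asboolP.
exists (block_mx v 0 0 w); rewrite adjmx_block !adjmx0 /=.
by rewrite !mulmx_block !mulmx0 !mul0mx !addr0 !add0r vp vq wp wq.
Qed.

Lemma mvn_dsumC p q : mvn (dsum p q) (dsum q p).
Proof.
apply/asboolP; exists (block_mx 0 (mmx p) (mmx q) 0) => /=.
case: p q => [m e [ee es]] [n f [ff fs]] /=.
rewrite adjmx_block !adjmx0 es fs !mulmx_block.
by rewrite !mulmx0 !mul0mx !addr0 !add0r ee ff.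
Qed.

Lemma mvn_cast n m (e : 'M[A]_n) (f : 'M[A]_m) (he : projmx e)
    (hf : projmx f) (nm : n = m) :
  castmx (nm, nm) e = f -> mvn (MProj he) (MProj hf).
Proof.
case: m / nm f hf => f hf; rewrite castmx_id => ef.
by case: f / ef hf => hf; rewrite (Prop_irrelevance hf he) mvn_refl.
Qed.

Lemma mvn_dsumA p q r : mvn (dsum p (dsum q r)) (dsum (dsum p q) r).
Proof.
case: p q r => [m e he] [n f hf] [k g hg].
apply: (@mvn_cast _ _ _ _ _ _ (addnA m n k)) => /=.
have := @block_mxA A m n k m n k e 0 0 0 f 0 0 0 g.
by rewrite /= !row_mx0 !col_mx0 => ->; rewrite castmx_comp castmx_id.
Qed.

Lemma mvn_dsum0 p : mvn (dsum proj0 p) p.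
Proof.
case: p => [m e he]; apply: (@mvn_cast _ _ _ _ _ _ (erefl m)).
rewrite castmx_id /=; apply/matrixP => i j; rewrite !mxE.
case: splitP => [[]//|i' ii']; rewrite !mxE; case: splitP => [[]//|j' jj'].
by congr (e _ _); apply/val_inj.
Qed.

(* V(A): the monoid of Murray-von Neumann classes of projections in matrices
   over A. *)
Definition mvn_monoid := {eq_quot mvn}.
HB.instance Definition _ := Choice.on mvn_monoid.

Definition mvn_class (p : mproj) : mvn_monoid := \pi_({eq_quot mvn}) p.

Definition vadd (x y : mvn_monoid) : mvn_monoid :=
  mvn_class (dsum (repr x) (repr y)).

Lemma vaddE p q : vadd (mvn_class p) (mvn_class q) = mvn_class (dsum p q).
Proof.
apply/eqmodP; apply: mvn_dsum; apply/eqmodP; exact: reprK.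
Qed.

Lemma vaddA : associative vadd.
Proof.
elim/quotW => p; elim/quotW => q; elim/quotW => r.
rewrite -!/(mvn_class _) !vaddE; apply/eqmodP; exact: mvn_dsumA.
Qed.

Lemma vaddC : commutative vadd.
Proof.
elim/quotW => p; elim/quotW => q.
rewrite -!/(mvn_class _) !vaddE; apply/eqmodP; exact: mvn_dsumC.
Qed.

Lemma vadd0 : left_id (mvn_class proj0) vadd.
Proof.
elim/quotW => p; rewrite -!/(mvn_class _) vaddE; apply/eqmodP.
exact: mvn_dsum0.
Qed.

HB.instance Definition _ := GRing.isNmodule.Build mvn_monoid vaddA vaddC vadd0.

End CStar.

(* The Grothendieck group of a commutative monoid: (x, y) stands for x - y. *)
Section Grothendieck.
Variable V : nmodType.

Definition grot_rel (x y : V * V) : bool :=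
  `[< exists r : V, x.1 + y.2 + r = y.1 + x.2 + r >].

Lemma grot_refl : reflexive grot_rel.
Proof. by move=> x; apply/asboolP; exists 0. Qed.

Lemma grot_sym : symmetric grot_rel.
Proof.
by move=> x y; apply/asboolP/asboolP => -[r h]; exists r.
Qed.

Lemma grot_trans : transitive grot_rel.
Proof.
move=> [b b'] [a a'] [c c'] /asboolP[r /= h] /asboolP[s /= k].
apply/asboolP; exists (b + b' + r + s) => /=.
transitivity ((a + b' + r) + (b + c' + s)).
  by rewrite (AC (2*4) ((1*4*5)*(3*2*6))).
rewrite h k.
by rewrite (AC (3*3) (4*2*(1*5*3*6))).
Qed.

Canonical grot_equiv := EquivRel grot_rel grot_refl grot_sym grot_trans.

Definition grothendieck := {eq_quot grot_rel}.
HB.instance Definition _ := Choice.on grothendieck.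

Definition grot_class (x : V * V) : grothendieck :=
  \pi_({eq_quot grot_rel}) x.

Definition grot_add (x y : grothendieck) : grothendieck :=
  grot_class ((repr x).1 + (repr y).1, (repr x).2 + (repr y).2).

Definition grot_opp (x : grothendieck) : grothendieck :=
  grot_class ((repr x).2, (repr x).1).

Lemma grot_addE x y : grot_add (grot_class x) (grot_class y) =
  grot_class (x.1 + y.1, x.2 + y.2).
Proof.
have /eqmodP/asboolP[r] : repr (grot_class x) = x %[mod_eq grot_rel].
  exact: reprK.
have /eqmodP/asboolP[s] : repr (grot_class y) = y %[mod_eq grot_rel].
  exact: reprK.
rewrite /grot_add; move: (repr (grot_class y)) (repr (grot_class x)) => y' x' hy hx.
apply/eqmodP/asboolP; exists (r + s) => /=.
transitivity ((x'.1 + x.2 + r) + (y'.1 + y.2 + s)).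
  by rewrite (AC (2*2*2) ((1*3*5)*(2*4*6))).
rewrite hx hy.
by rewrite (AC (3*3) ((1*4)*(2*5)*(3*6))).
Qed.

Lemma grot_oppE x : grot_opp (grot_class x) = grot_class (x.2, x.1).
Proof.
have /eqmodP/asboolP[r] : repr (grot_class x) = x %[mod_eq grot_rel].
  exact: reprK.
rewrite /grot_opp; move: (repr _) => x' hx.
apply/eqmodP/asboolP; exists r => /=.
by rewrite (addrC x'.2) (addrC x.2).
Qed.

Lemma grot_addA : associative grot_add.
Proof.
elim/quotW => x; elim/quotW => y; elim/quotW => z.
by rewrite -!/(grot_class _) !grot_addE /= !addrA.
Qed.

Lemma grot_addC : commutative grot_add.
Proof.
elim/quotW => x; elim/quotW => y; rewrite -!/(grot_class _) !grot_addE.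
by rewrite (addrC y.1) (addrC y.2).
Qed.

Lemma grot_add0 : left_id (grot_class (0, 0)) grot_add.
Proof.
by elim/quotW => -[x x']; rewrite -!/(grot_class _) grot_addE /= !add0r.
Qed.

Lemma grot_addN : left_inverse (grot_class (0, 0)) grot_opp grot_add.
Proof.
elim/quotW => x; rewrite -!/(grot_class _) grot_oppE grot_addE.
by apply/eqmodP/asboolP; exists 0; rewrite /= !addr0 add0r addrC.
Qed.

HB.instance Definition _ := GRing.isZmodule.Build grothendieck
  grot_addA grot_addC grot_add0 grot_addN.

End Grothendieck.

Section K0.
Variables (R : realType) (A : cstarAlgType R).

Definition K0 : zmodType := grothendieck (mvn_monoid A).

(* The class of a matrix projection e; the value on other matrices is
   irrelevant. *)
Definition K0_class n (e : 'M[A]_n) : K0 :=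
  if pselect (projmx e) is left he then grot_class (mvn_class (MProj he), 0)
  else 0.

(* The class of a projection of A itself, seen as a 1 x 1 matrix. *)
Definition K0_elt (p : A) : K0 := K0_class (p%:M : 'M[A]_1).

Definition K0_unit : K0 := K0_elt 1.

Definition K0_pos (x : K0) : Prop :=
  exists n (e : 'M[A]_n), projmx e /\ x = K0_class e.

Definition K0_le (x y : K0) : Prop := K0_pos (y - x).

Definition is_K0_meet (x y z : K0) : Prop :=
  [/\ K0_le z x, K0_le z y & forall w, K0_le w x -> K0_le w y -> K0_le w z].

(* Meaningful when K_0(A) is lattice-ordered, as it is for the algebras
   considered below. *)
Definition K0_meet (x y : K0) : K0 := xget 0 [set z | is_K0_meet x y z].

(* The image of K_0(J) in K_0(A). *)
Definition K0_ideal (J : set A) : set K0 :=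
  [set x | exists m n (e : 'M[A]_m) (f : 'M[A]_n),
     [/\ projmx e, projmx f, (forall i j, J (e i j)), (forall i j, J (f i j))
       & x = K0_class e - K0_class f]].

(* iota is an isomorphism of (K_0(A), K_0(A)^+, [1]) onto the subgroup G of V,
   ordered by leV, with unit u. *)
Definition unital_ordered_iso (V : zmodType) (G : set V) (leV : V -> V -> Prop)
    (u : V) (iota : K0 -> V) : Prop :=
  [/\ {morph iota : x y / x + y},
      injective iota,
      range iota = G,
      forall x y, K0_le x y <-> leV (iota x) (iota y) &
      iota K0_unit = u].

(* Elliott's monoid E(A), as the unit interval [0, [1]] of K_0(A). *)
Definition elliott : set K0 := [set x | K0_le 0 x /\ K0_le x K0_unit].
Definition elliott_star (x : K0) : K0 := K0_unit - x.
Definition elliott_oplus (x y : K0) : K0 := K0_meet (x + y) K0_unit.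

End K0.

Inductive formula :=
  | FZero
  | FX
  | FStar of formula
  | FOplus of formula & formula.

Inductive fsymbol := SZero | SX | SStar | SOplus | SLpar | SRpar.

Definition fsymbol_code (s : fsymbol) : 'I_6 :=
  match s with
  | SZero => inord 0 | SX => inord 1 | SStar => inord 2
  | SOplus => inord 3 | SLpar => inord 4 | SRpar => inord 5
  end.

Definition fsymbol_decode (i : 'I_6) : fsymbol :=
  nth SZero [:: SZero; SX; SStar; SOplus; SLpar; SRpar] i.

Lemma fsymbol_codeK : cancel fsymbol_code fsymbol_decode.
Proof. by case; rewrite /fsymbol_decode /= inordK. Qed.

HB.instance Definition _ := Finite.copy fsymbol (can_type fsymbol_codeK).

Fixpoint fstring (phi : formula) : seq fsymbol :=
  match phi with
  | FZero => [:: SZero]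
  | FX => [:: SX]
  | FStar phi => rcons (fstring phi) SStar
  | FOplus phi psi =>
      SLpar :: fstring phi ++ SOplus :: rcons (fstring psi) SRpar
  end.

Definition flength (phi : formula) : nat := size (fstring phi).

Section Interpretation.
Variables (R : realType) (A : cstarAlgType R).

Fixpoint coded (g : K0 A) (phi : formula) : K0 A :=
  match phi with
  | FZero => 0
  | FX => g
  | FStar phi => elliott_star (coded g phi)
  | FOplus phi psi => elliott_oplus (coded g phi) (coded g psi)
  end.

Definition elliott_generator (g : K0 A) : Prop :=
  elliott g /\ forall x, elliott x -> exists phi, coded g phi = x.

End Interpretation.

Section FareyEffrosShen.
Variable R : realType.

Definition I01 : set R := `[0, 1].

Definition mcnaughton : set (I01 -> R) :=
  [set f | continuous f /\
     exists s : seq (int * int), forall x : I01,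
       exists2 c, c \in s & f x = c.1%:~R + c.2%:~R * \val x].

Definition farey_algebra (A : cstarAlgType R) (iota : K0 A -> I01 -> R) : Prop :=
  AF_algebra A /\
  unital_ordered_iso mcnaughton (fun f g => forall x, f x <= g x) (cst 1) iota.

Definition effros_shen_algebra (theta : I01) (A : cstarAlgType R) : Prop :=
  AF_algebra A /\
  exists iota : K0 A -> R,
    unital_ordered_iso
      [set x | exists m n : int, x = m%:~R + n%:~R * \val theta]
      (fun x y => x <= y) 1 iota.

(* rho exhibits B as the quotient A / J. *)
Definition quotient_map (A B : cstarAlgType R) (J : set A)
    (rho : {lrmorphism A -> B}) : Prop :=
  [/\ forall x, rho (star x) = star (rho x),
      forall y, exists x, rho x = y &
      forall x, J x <-> rho x = 0].

Definition partial_quotient (theta : R) (n : nat) : int :=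
  Num.floor (iter n (fun x => (x - (Num.floor x)%:~R)^-1) theta).

End FareyEffrosShen.

Arguments I01 R : clear implicits.

(* Deterministic Turing machines with finitely many two-way infinite tapes.
   Tape 0 holds the input and the last tape the output. *)

Inductive tm_move := MoveLeft | Stay | MoveRight.

Definition move_offset (m : tm_move) : int :=
  match m with MoveLeft => -1 | Stay => 0 | MoveRight => 1 end.

(* None is the blank symbol. *)
Definition tm_cell (S W : finType) : finType := option (S + W)%type.

Record turing_machine (S : finType) := TuringMachine {
  tm_state : finType;
  tm_work : finType;
  tm_tapes : nat;  (* the number of tapes, minus one *)
  tm_start : tm_state;
  tm_accept : pred tm_state;
  (* None means that the machine halts *)
  tm_delta : tm_state -> {ffun 'I_tm_tapes.+1 -> tm_cell S tm_work} ->
    option (tm_state * {ffun 'I_tm_tapes.+1 -> tm_cell S tm_work} *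
            ('I_tm_tapes.+1 -> tm_move))
}.

Section TuringMachine.
Variables (S : finType) (M : turing_machine S).

Local Notation cell := (tm_cell S (tm_work M)).
Local Notation tape_index := 'I_(tm_tapes M).+1.

Record tm_config := TMConfig {
  cfg_state : tm_state M;
  cfg_tape : tape_index -> int -> cell;
  cfg_head : tape_index -> int
}.

Definition tape_word (w : seq S) (z : int) : cell :=
  if z is Posz k then omap inl (onth w k) else None.

Definition tm_init (w : seq S) : tm_config :=
  {| cfg_state := tm_start M;
     cfg_tape := fun i => tape_word (if i == ord0 then w else [::]);
     cfg_head := fun _ => 0 |}.

Definition tm_action (c : tm_config) :=
  tm_delta (cfg_state c) [ffun i => cfg_tape c i (cfg_head c i)].

Definition tm_halted (c : tm_config) : bool := ~~ isSome (tm_action c).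

Definition tm_next (c : tm_config) : tm_config :=
  if tm_action c is Some (q, wr, mv) then
    {| cfg_state := q;
       cfg_tape := fun i z =>
         if z == cfg_head c i then wr i else cfg_tape c i z;
       cfg_head := fun i => cfg_head c i + move_offset (mv i) |}
  else c.

Definition tm_run (w : seq S) (t : nat) : tm_config := iter t tm_next (tm_init w).

(* On input w, M halts after at most t steps with output v. *)
Definition tm_outputs (w v : seq S) (t : nat) : Prop :=
  tm_halted (tm_run w t) /\
  forall z, cfg_tape (tm_run w t) ord_max z = tape_word v z.

(* On input w, M halts after at most t steps, and accepts iff P holds. *)
Definition tm_answers (w : seq S) (P : Prop) (t : nat) : Prop :=
  tm_halted (tm_run w t) /\
  (tm_accept (cfg_state (tm_run w t)) <-> P).

End TuringMachine.

Fixpoint pos_bits (p : BinNums.positive) : seq bool :=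
  match p with
  | xH => [:: true]
  | xO p => rcons (pos_bits p) false
  | xI p => rcons (pos_bits p) true
  end.

(* Binary numerals, most significant bit first. *)
Definition nat_bits (n : nat) : seq bool :=
  if bin_of_nat n is Npos p then pos_bits p else [:: false].

(* Words over the alphabet {0, 1, separator}, the separator being None. *)
Definition unary (n : nat) : seq (option bool) := nseq n (Some true).

Definition binary_list (s : seq nat) : seq (option bool) :=
  flatten [seq rcons (map Some (nat_bits a)) None | a <- s].

(* theta lies in [0, 1], so its partial quotients are nonnegative. *)
Definition partial_quotients (R : realType) (theta : R) (n : nat) : seq nat :=
  [seq `|partial_quotient theta k|%N | k <- iota 0 n.+1].

Definition formula_pair (phi psi : formula) : seq (option fsymbol) :=
  map Some (fstring phi) ++ None :: map Some (fstring psi).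

(* Main.v *)
(* Since K_0(F) is a subgroup of the reals, the operations of E(F) are those of
   the unit interval: x* = 1 - x and x (+) y = min (x + y, 1), and the class of
   rho p has some value a + b theta in [0, 1], with a and b integers. A formula
   of length l then has a value m + n theta with |n| <= (|b| + 1) l. Let N be
   (|b| + 1) times the length of the input. Running the continued fraction
   recurrence for theta one addition at a time, and stopping as soon as the sum
   of the last two denominators exceeds N, yields fractions xp / xq and yp / yq
   with determinant +-1 such that theta lies strictly between them. So does
   their mediant P / Q, and hence m + n theta and m Q + n P have the same sign
   whenever |n| <= N. The formulas may therefore be evaluated in the finite
   chain {0, ..., Q}, with 1 replaced by Q and theta by P.

   As P, Q and N are linearly bounded in the length of the input, unary
   arithmetic is good enough. The denominators grow exponentially, so that
   O(log N) partial quotients suffice; they are computed in 2 ^ O(log N)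
   steps. *)
Require Import Defs.
From HB Require Import structures.
From mathcomp Require Import all_boot all_order all_algebra.
From mathcomp Require Import generic_quotient complex.
From mathcomp Require Import all_classical all_reals all_analysis.
From mathcomp Require Import zify ring lra.

Set Implicit Arguments.
Unset Strict Implicit.
Unset Printing Implicit Defensive.

Import Order.TTheory GRing.Theory Num.Theory.
Import numFieldNormedType.Exports.

Local Open Scope nat_scope.

(** * A While language compiled to multitape Turing machines *)

(** Nothing is known of the given machine [M] but its output and its time: it may halt with its
    heads anywhere, and the quotients that it writes may exceed every polynomial in N. It is
    therefore simulated step by step inside a larger machine, written in a small While language
    whose steps depend on the scanned cells only and whose semantics counts them. A quotient is
    never converted to unary. Its bits are accumulated only up to a threshold, the number of
    additions after which the walk stops anyhow. The argument given to [M] is 2k, where k is the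
    least integer with 2^k > N: each quotient at least doubles the square of the sum of the last two
    denominators, so that 2k of them lead beyond N. The integers a and b depend on the algebra and
    its generator, not on the formulas, and are built into the program. *)

Inductive counter :=
  | cLen | cFuel | cDouble | cPow | cTmp | cTmp2 | cArg | cRight | cLeft
  | cXp | cXq | cYp | cYq | cRest | cTimes | cGen | cA | cB | cStk.

Definition counter_rank (c : counter) : nat :=
  match c with
  | cLen => 0 | cFuel => 1 | cDouble => 2 | cPow => 3 | cTmp => 4 | cTmp2 => 5
  | cArg => 6 | cRight => 7 | cLeft => 8 | cXp => 9 | cXq => 10 | cYp => 11
  | cYq => 12 | cRest => 13 | cTimes => 14 | cGen => 15 | cA => 16 | cB => 17
  | cStk => 18
  end.

Definition counter_code (c : counter) : 'I_19 := inord (counter_rank c).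

Definition counter_decode (i : 'I_19) : counter :=
  nth cStk [:: cLen; cFuel; cDouble; cPow; cTmp; cTmp2; cArg; cRight; cLeft;
            cXp; cXq; cYp; cYq; cRest; cTimes; cGen; cA; cB; cStk] i.

Lemma counter_codeK : cancel counter_code counter_decode.
Proof. by case; rewrite /counter_decode /= inordK. Qed.

HB.instance Definition _ := Finite.copy counter (can_type counter_codeK).

(* A computable equality test: the generic [==] goes through [inord]. *)
Definition same_counter (c d : counter) : bool :=
  eqn (counter_rank c) (counter_rank d).

Lemma same_counterP c d : reflect (c = d) (same_counter c d).
Proof. by apply: (iffP idP) => [|->]; [case: c d => [] [] | case: d]. Qed.

Definition counter_in (c : counter) (s : seq counter) : bool :=
  has (same_counter c) s.

Section Language.
Variables (S : finType) (M : turing_machine (option bool)).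

Local Notation mtape := 'I_(tm_tapes M).+1.
Local Notation mcell := (tm_cell (option bool) (tm_work M)).

(* The counters are kept in unary, as the distance of a head from a marker on
   its tape. The tape of [cStk] may hold several markers: it is a stack whose
   top is the counter [cStk] and whose other entries are listed in [stk]. *)
Record mem := Mem {
  ctr : counter -> nat;
  stk : seq nat;
  ihd : int;
  mcfg : tm_config M
}.

(** All that one step may depend on. It is determined by the scanned cells, so that tests and
    instructions computed from it form a transition table. *)
Record view := View {
  vzero : counter -> bool;
  vin : option S;
  vstate : tm_state M;
  vcells : {ffun mtape -> mcell}
}.

(* [i_stk] pushes ([Some true]) or pops ([Some false]) a marker. *)
Record instr := Instr {
  i_ctr : counter -> tm_move;
  i_stk : option bool;
  i_in : tm_move;
  i_sim : option (tm_state M * {ffun mtape -> mcell} * (mtape -> tm_move))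
}.

Variable w : seq S.

Definition input_at (z : int) : option S :=
  if z is Posz k then onth w k else None.

Definition look (m : mem) : view :=
  View (fun c => ctr m c == 0) (input_at (ihd m)) (cfg_state (mcfg m))
       [ffun i => cfg_tape (mcfg m) i (cfg_head (mcfg m) i)].

Definition bump (mv : tm_move) (n : nat) : nat :=
  match mv with MoveLeft => n.-1 | Stay => n | MoveRight => n.+1 end.

Definition perform_ctr (i : instr) (m : mem) (c : counter) : nat :=
  match c, i_stk i with
  | cStk, Some true => 0
  | cStk, Some false => head 0 (stk m)
  | _, _ => bump (i_ctr i c) (ctr m c)
  end.

Definition perform_stk (i : instr) (m : mem) : seq nat :=
  match i_stk i with
  | Some true => (ctr m cStk).-1 :: stk m
  | Some false => behead (stk m)
  | None => stk m
  end.

Definition perform_sim (i : instr) (c : tm_config M) : tm_config M :=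
  if i_sim i is Some (q, wr, mv) then
    {| cfg_state := q;
       cfg_tape := fun j z =>
         if z == cfg_head c j then wr j else cfg_tape c j z;
       cfg_head := fun j => (cfg_head c j + move_offset (mv j))%R |}
  else c.

Definition perform (i : instr) (m : mem) : mem :=
  Mem (perform_ctr i m) (perform_stk i m)
      (ihd m + move_offset (i_in i))%R (perform_sim i (mcfg m)).

(* A marker is pushed one cell to the right of the head of a nonzero counter,
   and is popped only when the head is on it and it is not the last one. *)
Definition legal (i : instr) (m : mem) : bool :=
  match i_stk i with
  | Some true => 0 < ctr m cStk
  | Some false => (ctr m cStk == 0) && (stk m != [::])
  | None => true
  end.

Inductive prog :=
  | Step of (view -> instr)
  | Seq of prog & prog
  | If of (view -> bool) & prog & prog
  | While of (view -> bool) & prog.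

Inductive exec : prog -> mem -> mem -> nat -> Prop :=
  | ExecStep f m : legal (f (look m)) m ->
      exec (Step f) m (perform (f (look m)) m) 1
  | ExecSeq p q m1 m2 m3 t1 t2 : exec p m1 m2 t1 -> exec q m2 m3 t2 ->
      exec (Seq p q) m1 m3 (t1 + t2)
  | ExecThen (b : view -> bool) p q m1 m2 t : b (look m1) -> exec p m1 m2 t ->
      exec (If b p q) m1 m2 t.+1
  | ExecElse (b : view -> bool) p q m1 m2 t : ~~ b (look m1) ->
      exec q m1 m2 t ->
      exec (If b p q) m1 m2 t.+1
  | ExecDone (b : view -> bool) p m : ~~ b (look m) -> exec (While b p) m m 1
  | ExecLoop (b : view -> bool) p m1 m2 m3 t1 t2 : b (look m1) ->
      exec p m1 m2 t1 -> exec (While b p) m2 m3 t2 ->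
      exec (While b p) m1 m3 (t1 + t2).+1.

Definition idle : instr := Instr (fun=> Stay) None Stay None.

Lemma perform_idle m : perform idle m = m.
Proof.
case: m => c s h k; rewrite /perform /= addr0; congr Mem.
by apply/funext; case.
Qed.

(** The additional state [None] of [If] and [While] evaluates the test during one idle step; hence
    the extra unit of cost in [exec]. *)
Fixpoint pstate (p : prog) : finType :=
  match p with
  | Step _ => unit
  | Seq p q => (pstate p + pstate q)%type
  | If _ p q => option (pstate p + pstate q)
  | While _ p => option (pstate p)
  end.

Fixpoint pstart (p : prog) : pstate p :=
  match p with
  | Step _ => tt
  | Seq p q => inl (pstart p)
  | If _ _ _ => None
  | While _ _ => None
  end.

(* The new state is [None] when the program terminates. *)
Fixpoint pdelta (p : prog) : pstate p -> view -> option (pstate p) * instr :=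
  match p with
  | Step f => fun _ v => (None, f v)
  | Seq p q => fun s v =>
      match s with
      | inl s => let: (o, i) := pdelta s v in
          (Some (if o is Some s' then inl s' else inr (pstart q)), i)
      | inr s => let: (o, i) := pdelta s v in (omap inr o, i)
      end
  | If b p q => fun s v =>
      match s with
      | None => (Some (Some (if b v then inl (pstart p) else inr (pstart q))),
                 idle)
      | Some (inl s) => let: (o, i) := pdelta s v in
          (omap (Some \o inl) o, i)
      | Some (inr s) => let: (o, i) := pdelta s v in
          (omap (Some \o inr) o, i)
      end
  | While b p => fun s v =>
      match s with
      | None => (if b v then Some (Some (pstart p)) else None, idle)
      | Some s => let: (o, i) := pdelta s v in (Some o, i)
      end
  end.

Fixpoint prun (p : prog) (n : nat) (o : option (pstate p)) (m : mem)
    (o' : option (pstate p)) (m' : mem) : Prop :=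
  if n is n'.+1 then
    if o is Some s then
      let i := (pdelta s (look m)).2 in
      legal i m /\ prun n' (pdelta s (look m)).1 (perform i m) o' m'
    else False
  else o = o' /\ m = m'.

Lemma prun_add p n1 n2 o1 o2 o3 m1 m2 m3 :
  @prun p n1 o1 m1 o2 m2 -> prun n2 o2 m2 o3 m3 -> prun (n1 + n2) o1 m1 o3 m3.
Proof.
elim: n1 o1 m1 => [|n1 ih] o1 m1 /=; first by case=> -> ->.
by case: o1 => // s [? /ih h] /h.
Qed.

(* [o0] is where the context [q] resumes once [p] has terminated. *)
Lemma prun_context p q (f : pstate p -> pstate q) (o0 : option (pstate q)) :
  (forall s v, pdelta (f s) v =
     (if (pdelta s v).1 is Some s' then Some (f s') else o0, (pdelta s v).2)) ->
  forall n s m m', prun n (Some s) m None m' -> prun n (Some (f s)) m o0 m'.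
Proof.
move=> hf; elim=> [|n ih] s m m' /=; first by case.
case=> hl hr; split; first by rewrite hf.
rewrite hf /=; case: (pdelta s (look m)).1 hr => [s'|]; first exact: ih.
by case: (n) => // -[_ ->].
Qed.

Lemma exec_prun p m m' t : exec p m m' t -> prun t (Some (pstart p)) m None m'.
Proof.
elim=> {p m m' t} /=.
- by move=> f m hl; split.
- move=> p q m1 m2 m3 t1 t2 _ h1 _ h2.
  apply: (@prun_add (Seq p q) t1 t2 _ (Some (inr (pstart q))) _ m1 m2).
    apply: (@prun_context p (Seq p q) inl) h1 => s v /=.
    by case: (pdelta s v) => -[].
  apply: (@prun_context q (Seq p q) inr None) h2 => s v /=.
  by case: (pdelta s v) => -[].
- move=> b p q m1 m2 t hb _ h; split => //; rewrite hb perform_idle.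
  apply: (@prun_context p (If b p q) (Some \o inl) None) h => s v /=.
  by case: (pdelta s v) => -[].
- move=> b p q m1 m2 t /negPf hb _ h; split => //; rewrite hb perform_idle.
  apply: (@prun_context q (If b p q) (Some \o inr) None) h => s v /=.
  by case: (pdelta s v) => -[].
- by move=> b p m /negPf hb; split => //; rewrite hb perform_idle.
- move=> b p m1 m2 m3 t1 t2 hb _ h1 _ h2; split => //; rewrite hb perform_idle.
  apply: (@prun_add (While b p) _ _ _ (Some None) _ _ _ _ _ h2).
  apply: (@prun_context p (While b p) Some (Some None)) h1 => s v /=.
  by case: (pdelta s v) => -[].
Qed.

(** The state of [M] is a symbol, kept on a tape of its own, so that the control states depend on
    the program alone. *)
Definition work := ((option bool + tm_work M) + (tm_state M + unit))%type.
Definition cell := tm_cell S work.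
Definition tindex := option (counter + (mtape + unit)).

Definition mark : cell := Some (inr (inr (inr tt))).
Definition state_cell (q : tm_state M) : cell := Some (inr (inr (inl q))).
Definition sim_cell (c : mcell) : cell := omap (fun x => inr (inl x)) c.
Definition cell_sim (c : cell) : mcell :=
  if c is Some (inr (inl x)) then Some x else None.

Lemma sim_cellK : cancel sim_cell cell_sim.
Proof. by case. Qed.

(** The position of the top marker. A marker fills a cell, so that an entry [n] takes [n + 1] cells:
    a push writes the marker one cell beyond the saved value, and a pop, which erases it and moves
    left, lands on that value again. *)
Fixpoint stack_base (s : seq nat) : nat :=
  if s is n :: s' then (stack_base s' + n).+1 else 0.

Fixpoint stack_tape (s : seq nat) (z : int) : cell :=
  if z == stack_base s then mark
  else if s is _ :: s' then stack_tape s' z else None.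

Lemma stack_tape_gt s (z : int) : (Posz (stack_base s) < z)%R ->
  stack_tape s z = None.
Proof.
elim: s => [|n s ih] /= hz; rewrite gt_eqF //.
by apply: ih; apply: lt_trans hz; rewrite ltz_nat; lia.
Qed.

Lemma stack_tape_top s n :
  (stack_tape s (stack_base s + n)%:Z == mark) = (n == 0).
Proof.
case: n => [|n]; first by rewrite addn0; case: s => [|m s] /=; rewrite !eqxx.
by rewrite stack_tape_gt // ltz_nat; lia.
Qed.

Definition counter_stack (m : mem) (c : counter) : seq nat :=
  if c is cStk then stk m else [::].

Definition mtape_of (m : mem) (i : tindex) : int -> cell :=
  match i with
  | None => fun z => omap inl (input_at z)
  | Some (inl c) => stack_tape (counter_stack m c)
  | Some (inr (inl j)) => fun z => sim_cell (cfg_tape (mcfg m) j z)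
  | Some (inr (inr _)) => fun z =>
      if z == 0%R then state_cell (cfg_state (mcfg m)) else None
  end.

Definition mhead_of (m : mem) (i : tindex) : int :=
  match i with
  | None => ihd m
  | Some (inl c) => stack_base (counter_stack m c) + ctr m c
  | Some (inr (inl j)) => cfg_head (mcfg m) j
  | Some (inr (inr _)) => 0%R
  end.

Definition read_view (r : tindex -> cell) : view :=
  View (fun c => r (Some (inl c)) == mark)
       (if r None is Some (inl x) then Some x else None)
       (if r (Some (inr (inr tt))) is Some (inr (inr (inl q))) then q
        else tm_start M)
       [ffun j => cell_sim (r (Some (inr (inl j))))].

Definition iwrite (i : instr) (r : tindex -> cell) (j : tindex) : cell :=
  match j with
  | None => r j
  | Some (inl c) =>
      match c, i_stk i with
      | cStk, Some true => mark
      | cStk, Some false => None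
      | _, _ => r j
      end
  | Some (inr (inl k)) =>
      if i_sim i is Some (_, wr, _) then sim_cell (wr k) else r j
  | Some (inr (inr _)) =>
      if i_sim i is Some (q, _, _) then state_cell q else r j
  end.

(** Except in a pop, a head that is on a marker does not move left; this realizes the truncated
    predecessor in [bump]. *)
Definition imove (i : instr) (r : tindex -> cell) (j : tindex) : tm_move :=
  match j with
  | None => i_in i
  | Some (inl c) =>
      let mv := match i_ctr i c with
                | MoveLeft => if r j == mark then Stay else MoveLeft
                | mv => mv
                end in
      match c, i_stk i with
      | cStk, Some true => Stay
      | cStk, Some false => MoveLeft
      | _, _ => mv
      end
  | Some (inr (inl k)) => if i_sim i is Some (_, _, mv) then mv k else Stay
  | Some (inr (inr _)) => Stay
  end.

Definition reads (m : mem) (j : tindex) : cell := mtape_of m j (mhead_of m j).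

Lemma reads_counter m c : (reads m (Some (inl c)) == mark) = (ctr m c == 0).
Proof. exact: stack_tape_top. Qed.

Lemma read_viewE m : read_view (reads m) = look m.
Proof.
congr View.
- by apply/funext => c; rewrite reads_counter.
- by rewrite /reads /=; case: (input_at _).
- by apply/ffunP => j; rewrite !ffunE /reads /= sim_cellK.
Qed.

Lemma perform_tape i m j : legal i m ->
  mtape_of (perform i m) j =
  (fun z => if z == mhead_of m j then iwrite i (reads m) j else mtape_of m j z).
Proof.
rewrite /legal => hl; apply/funext => z; rewrite /reads.
case: j => [[c|[j|u]]|] /=; first last.
- by case: eqVneq => [->|].
- rewrite /perform_sim; case: (i_sim i) => [[[q wr] mv]|] /=; case: ifP => //.
- rewrite /perform_sim; case: (i_sim i) => [[[q wr] mv]|] /=; case: ifP => //.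
  by move/eqP->.
have same (d : int -> cell) y : d z = (if z == y then d y else d z).
  by case: eqVneq => [->|].
case: c; try exact: same.
rewrite /= /perform_stk; case: (i_stk i) hl => [[]|] /= hl; last exact: same.
  suff -> : (stack_base (stk m) + (ctr m cStk).-1).+1 =
      stack_base (stk m) + ctr m cStk by [].
  by lia.
case/andP: hl => /eqP -> ; case: (stk m) => // n s _ /=; rewrite addr0.
by case: eqVneq => // ->; rewrite stack_tape_gt // ltz_nat; lia.
Qed.

Lemma perform_head i m j : legal i m ->
  mhead_of (perform i m) j =
  (mhead_of m j + move_offset (imove i (reads m) j))%R.
Proof.
rewrite /legal => hl; case: j => [[c|[j|u]]|] //=; first last.
  by rewrite /perform_sim; case: (i_sim i) => [[[q wr] mv]|] /=; rewrite ?addr0.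
set mv := match i_ctr i c with MoveLeft => _ | _ => _ end.
have hmv : Posz (bump (i_ctr i c) (ctr m c)) =
    (Posz (ctr m c) + move_offset mv)%R.
  rewrite /mv; case: (i_ctr i c) => /=; rewrite ?addr0 //.
    by rewrite reads_counter; case: eqVneq => /=; lia.
  by lia.
have hmv' s : (Posz (stack_base s) + Posz (bump (i_ctr i c) (ctr m c)))%R =
    (Posz (stack_base s) + Posz (ctr m c) + move_offset mv)%R.
  by rewrite -addrA -hmv.
case: c mv hmv hmv'; try by move=> mv hmv hmv'; exact: hmv'.
move=> mv hmv hmv'; rewrite /= /perform_ctr /perform_stk.
case: (i_stk i) hl => [[]|] hl; last exact: hmv'.
  by case: (ctr m cStk) hl => // n _ /=; lia.
by case/andP: hl => /eqP ->; case: (stk m) => //= n s _; lia.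
Qed.

Definition tape_rank (j : tindex) : 'I_(#|{: counter + (mtape + unit)}|).+1 :=
  if j is Some k then lift ord0 (enum_rank k) else ord0.

Definition tape_of_rank (i : 'I_(#|{: counter + (mtape + unit)}|).+1) :
    tindex :=
  omap enum_val (unlift ord0 i).

Lemma tape_rankK : cancel tape_rank tape_of_rank.
Proof.
by case=> [k|]; rewrite /tape_of_rank /= ?unlift_none // liftK /= enum_rankK.
Qed.

Lemma tape_of_rankK : cancel tape_of_rank tape_rank.
Proof.
move=> i; rewrite /tape_of_rank; case: unliftP => [k|] -> //=.
by rewrite enum_valK.
Qed.

(** Work tapes are blank at the start, whereas [mem0] needs a marker on each counter tape and the
    start state of [M] on the state tape. *)
Definition first_write (r : tindex -> cell) (j : tindex) : cell :=
  match j with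
  | Some (inl _) => mark
  | Some (inr (inr _)) => state_cell (tm_start M)
  | _ => r j
  end.

Variables (p : prog) (acc : view -> bool).

Definition machine_delta (s : option (pstate p) + option bool)
    (r : {ffun 'I_(#|{: counter + (mtape + unit)}|).+1 -> cell}) :=
  let r' j := r (tape_rank j) in
  match s with
  | inr None => Some (inl (Some (pstart p)) : option (pstate p) + option bool,
      [ffun k => first_write r' (tape_of_rank k)], fun=> Stay)
  | inl (Some s') => let: (o, i) := pdelta s' (read_view r') in
      Some (inl o, [ffun k => iwrite i r' (tape_of_rank k)],
            fun k => imove i r' (tape_of_rank k))
  | inl None => Some (inr (Some (acc (read_view r'))), r, fun=> Stay)
  | inr (Some _) => None
  end.

Definition machine : turing_machine S :=
  {| tm_state := (option (pstate p) + option bool)%type;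
     tm_work := work;
     tm_tapes := #|{: counter + (mtape + unit)}|;
     tm_start := inr None;
     tm_accept := fun s => if s is inr (Some b) then b else false;
     tm_delta := machine_delta |}.

Definition machine_config (s : tm_state machine) (m : mem) :
    tm_config machine :=
  @TMConfig S machine s (fun i => mtape_of m (tape_of_rank i))
                (fun i => mhead_of m (tape_of_rank i)).

Definition mem0 : mem := Mem (fun=> 0) [::] 0%R (tm_init M [::]).

Lemma tm_action_config s m :
  tm_action (machine_config s m) =
  @machine_delta s [ffun i => reads m (tape_of_rank i)].
Proof. by []. Qed.

Lemma reads_rank m :
  (fun j => [ffun i => reads m (tape_of_rank i)] (tape_rank j)) = reads m.
Proof. by apply/funext => j; rewrite ffunE tape_rankK. Qed.

Lemma machine_next s m : legal (pdelta s (look m)).2 m ->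
  tm_next (machine_config (inl (Some s)) m) =
  machine_config (inl (pdelta s (look m)).1) (perform (pdelta s (look m)).2 m).
Proof.
rewrite /tm_next tm_action_config /machine_delta reads_rank read_viewE.
case: (pdelta s (look m)) => o i /= hl; rewrite /machine_config.
congr TMConfig; apply/funext => k; last by rewrite perform_head.
rewrite perform_tape //; apply/funext => z; case: eqVneq => // _.
by rewrite ffunE.
Qed.

Lemma machine_run n o m o' m' : prun n o m o' m' ->
  iter n (@tm_next S machine) (machine_config (inl o) m) =
  machine_config (inl o') m'.
Proof.
elim: n o m => [|n ih] o m; first by case=> -> ->.
by case: o => // s [hl /ih h]; rewrite iterSr machine_next.
Qed.

Lemma tape_word_nil (S' : finType) (M' : turing_machine S') z :
  tape_word M' [::] z = None.
Proof. by case: z => // -[]. Qed.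

Lemma machine_first :
  tm_next (tm_init machine w) = machine_config (inl (Some (pstart p))) mem0.
Proof.
rewrite /tm_next /tm_action /= /machine_config; congr TMConfig; last first.
  apply/funext => k; rewrite addr0.
  by case: (tape_of_rank k) => [[[]|[]]|].
apply/funext => k; apply/funext => z; rewrite ffunE /=.
have hk : (k == ord0) = (tape_of_rank k == None).
  apply/eqP/eqP => [->|h]; first by rewrite /tape_of_rank unlift_none.
  by rewrite -[k]tape_of_rankK h.
case: (tape_of_rank k) hk => [j|] /= ->; rewrite ?ffunE ?eqxx /=.
  case: j => [c|[j|u]] /=;
    rewrite ?ffunE /= ?tape_word_nil ?if_same ?tape_word_nil //.
  by case: c.
by case: eqVneq => [->|_] //; case: z.
Qed.

(** The two extra steps print the initial markers and store the verdict [acc] in the state, on which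
    acceptance depends. *)
Lemma machine_answers m t : exec p mem0 m t ->
  tm_answers machine w (acc (look m)) t.+2.
Proof.
move=> /exec_prun /machine_run h.
rewrite /tm_answers /tm_run iterS iterSr machine_first h.
rewrite /tm_next tm_action_config /= reads_rank read_viewE.
by rewrite /tm_halted /tm_action.
Qed.

End Language.

(** * Unary arithmetic *)

Section Macros.
Variables (S : finType) (M : turing_machine (option bool)) (w : seq S).

Local Notation mem := (mem M).
Local Notation view := (view S M).
Local Notation prog := (prog S M).
Local Notation look := (look w).
Local Notation mtape := 'I_(tm_tapes M).+1.

Definition runs (p : prog) (m m' : mem) (T : nat) : Prop :=
  exists2 t, t <= T & exec w p m m' t.

Lemma runs_step f m m' : legal (f (look m)) m -> perform (f (look m)) m = m' ->
  runs (Step f) m m' 1.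
Proof. by move=> hl <-; exists 1 => //; constructor. Qed.

Lemma runs_seq p q m1 m2 m3 T1 T2 T : runs p m1 m2 T1 -> runs q m2 m3 T2 ->
  T1 + T2 <= T -> runs (Seq p q) m1 m3 T.
Proof.
move=> [t1 h1 e1] [t2 h2 e2] h; exists (t1 + t2); first by lia.
exact: ExecSeq e1 e2.
Qed.

Lemma runs_le p m m' T T' : runs p m m' T -> T <= T' -> runs p m m' T'.
Proof. by move=> [t h e] h'; exists t => //; lia. Qed.

Lemma runs_if (b : view -> bool) p q m m' T :
  (if b (look m) then runs p m m' T else runs q m m' T) ->
  runs (If b p q) m m' T.+1.
Proof.
case: (boolP (b (look m))) => hb [t h e]; exists t.+1 => //.
  exact: ExecThen.
exact: ExecElse.
Qed.

Lemma runs_while (st : nat -> mem) n (b : view -> bool) body T :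
  (forall i, i < n -> b (look (st i)) /\ runs body (st i) (st i.+1) T) ->
  ~~ b (look (st n)) ->
  runs (While b body) (st 0) (st n) (n * T.+1 + 1).
Proof.
elim: n st => [|n ih] st hi hn; first by exists 1 => //; constructor.
have [hb [t1 h1 e1]] := hi 0 isT.
have [|t2 h2 e2] := ih (st \o succn) _ hn.
  by move=> i hin; apply: hi.
exists (t1 + t2).+1; first by rewrite mulSn; lia.
exact: ExecLoop e2.
Qed.

(** The invariant sees the unread part of the word: for the evaluation of formulas it has to say
    that the remaining symbols never pop an empty stack. *)
Lemma runs_while_word (A X : Type) (u : seq X) (d : A -> X -> A)
    (Inv : A -> seq X -> Prop) (st : nat -> A -> mem) (b : view -> bool)
    body T a :
  Inv a u ->
  (forall k a x r, onth u k = Some x -> Inv a (x :: r) ->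
    [/\ b (look (st k a)), Inv (d a x) r &
        runs body (st k a) (st k.+1 (d a x)) T]) ->
  (forall a, Inv a [::] -> ~~ b (look (st (size u) a))) ->
  runs (While b body) (st 0 a) (st (size u) (foldl d a u)) (size u * T.+1 + 1).
Proof.
elim: u st a => [|x u ih] st a ha hs he.
  by exists 1 => //; constructor; apply: he.
have [hb ha' [t1 h1 e1]] := hs 0 a x u erefl ha.
have [||t2 h2 e2] := ih (st \o succn) _ ha'.
- by move=> k c y r hk hc; apply: hs.
- by move=> c hc; apply: he.
exists (t1 + t2).+1; first by rewrite /= mulSn; lia.
exact: ExecLoop e2.
Qed.

(** Unrolled repetition, for the constants that belong to the machine and not to its data. *)
Fixpoint times n (p : prog) : prog :=
  if n is n'.+1 then Seq p (times n' p) else Step (fun=> idle M).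

Lemma runs_times (st : nat -> mem) n p T :
  (forall i, i < n -> runs p (st i) (st i.+1) T) ->
  runs (times n p) (st 0) (st n) (n * T + 1).
Proof.
elim: n st => [|n ih] st hi.
  by apply: runs_step => //; rewrite perform_idle.
apply: runs_seq (hi 0 isT) (ih (st \o succn) _) _; last by rewrite mulSn; lia.
by move=> i hin; apply: hi.
Qed.

Definition set_ctr (m : mem) (c : counter -> nat) : mem :=
  Mem c (stk m) (ihd m) (mcfg m).

Definition counter_moves (incs decs : seq counter) (c : counter) : tm_move :=
  if counter_in c incs then MoveRight
  else if counter_in c decs then MoveLeft else Stay.

Definition bumps incs decs : view -> instr M :=
  fun _ => Instr (counter_moves incs decs) None Stay None.

Definition bumped incs decs (c : counter -> nat) (j : counter) : nat :=
  bump (counter_moves incs decs j) (c j).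

Lemma runs_bumps incs decs m c :
  bumped incs decs (ctr m) = c ->
  runs (Step (bumps incs decs)) m (set_ctr m c) 1.
Proof.
move=> <-; apply: runs_step => //; rewrite /perform /set_ctr /= addr0.
by congr Mem; apply/funext; case.
Qed.

Definition nonzero (c : counter) : view -> bool := fun v => ~~ vzero v c.

(* The counter x.1.1 is emptied into those of x.1.2, and subtracted (with
   truncation) from those of x.2. *)
Definition move_counter (x : counter * seq counter * seq counter) : prog :=
  While (nonzero x.1.1) (Step (bumps x.1.2 (x.1.1 :: x.2))).

Definition moved (x : counter * seq counter * seq counter)
    (c : counter -> nat) (j : counter) : nat :=
  if same_counter j x.1.1 then 0
  else if counter_in j x.1.2 then c j + c x.1.1
  else if counter_in j x.2 then c j - c x.1.1 else c j.

Lemma runs_move_counter x m : ~~ counter_in x.1.1 x.1.2 ->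
  runs (move_counter x) m (set_ctr m (moved x (ctr m))) (2 * ctr m x.1.1 + 1).
Proof.
case: x => [[i incs] decs] /= hi.
pose st k := set_ctr m (fun j => if same_counter j i then ctr m i - k
  else if counter_in j incs then ctr m j + k
  else if counter_in j decs then ctr m j - k else ctr m j).
have hii : same_counter i i by apply/same_counterP.
have -> : m = st 0.
  case: m @st => c s h k; rewrite /set_ctr /=; congr Mem; apply/funext => j.
  by case: same_counterP => [->|_]; rewrite ?subn0 ?addn0 ?if_same.
have -> : set_ctr (st 0) (moved (i, incs, decs) (ctr (st 0))) = st (ctr m i).
  rewrite /st /set_ctr /moved /=; congr Mem; apply/funext => j /=.
  case: same_counterP => [_|hji]; first by rewrite subnn.
  by rewrite hii !subn0 !addn0 !if_same.
rewrite {3}/st /= hii subn0 mulnC.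
apply: (@runs_while st _ _ _ 1) => [k hk|]; last first.
  by rewrite /nonzero /= hii subnn.
rewrite /nonzero /= hii; split; first by lia.
rewrite -[st k.+1]/(set_ctr (st k) (ctr (st k.+1))).
apply: runs_bumps; apply/funext => j; rewrite /bumped /counter_moves /=.
case: same_counterP => [->|_] /=; first by rewrite (negPf hi) /=; lia.
by case: (counter_in j incs) => /=; [|case: (counter_in j decs) => /=]; lia.
Qed.

Fixpoint moves (l : seq (counter * seq counter * seq counter)) : prog :=
  if l is x :: l' then Seq (move_counter x) (moves l')
  else Step (fun=> idle M).

Fixpoint moves_ctr (l : seq (counter * seq counter * seq counter))
    (c : counter -> nat) : counter -> nat :=
  if l is x :: l' then moves_ctr l' (moved x c) else c.

Fixpoint moves_cost (l : seq (counter * seq counter * seq counter))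
    (c : counter -> nat) : nat :=
  if l is x :: l' then 2 * c x.1.1 + 1 + moves_cost l' (moved x c) else 1.

Lemma runs_moves l m c T :
  all (fun x => ~~ counter_in x.1.1 x.1.2) l ->
  (forall j, moves_ctr l (ctr m) j = c j) -> moves_cost l (ctr m) <= T ->
  runs (moves l) m (set_ctr m c) T.
Proof.
move=> hl /funext <- hT; apply: runs_le hT.
elim: l m hl => [|x l ih] m /=.
  move=> _; apply: runs_step => //; rewrite perform_idle.
  by case: (m).
case/andP=> hx hl; apply: runs_seq (runs_move_counter _ hx) (ih _ hl) _.
exact: leqnn.
Qed.

End Macros.

Arguments runs_seq {S M w p q m1} m2 {m3} T1 T2 {T} _ _ _.
Arguments runs_while {S M w} st {n b body T} _ _.
Arguments runs_times {S M w} st {n p T} _.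
Arguments runs_bumps {S M w incs decs} m {c} _.
Arguments runs_moves {S M w l} m c {T} _ _ _.
Arguments moves {S M} l : simpl never.
Arguments nonzero {S M} c.

(** * Running the machine that computes the partial quotients *)

Section Preparation.
Variables (S : finType) (M : turing_machine (option bool)) (w : seq S).

Local Notation mem := (mem M).
Local Notation view := (view S M).
Local Notation prog := (prog S M).
Local Notation look := (look w).
Local Notation runs := (@runs S M w).
Local Notation mtape := 'I_(tm_tapes M).+1.

Definition go incs decs (mv : tm_move) : view -> instr M :=
  fun _ => Instr (counter_moves incs decs) None mv None.

Lemma runs_go incs decs mv m c : (forall j, bumped incs decs (ctr m) j = c j) ->
  runs (Step (go incs decs mv)) m
    (Mem c (stk m) (ihd m + move_offset mv)%R (mcfg m)) 1.
Proof.
move=> /funext <-; apply: runs_step => //.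
by congr Mem; apply/funext; case.
Qed.

Definition glide incs decs (j : mtape) (mv : tm_move) : view -> instr M :=
  fun v => Instr (counter_moves incs decs) None Stay
    (Some (vstate v, vcells v, fun k => if k == j then mv else Stay)).

Definition at_head (c : tm_config M) (j : mtape) (z : int) : tm_config M :=
  TMConfig (cfg_state c) (cfg_tape c)
           (fun k => if k == j then z else cfg_head c k).

Lemma runs_glide incs decs j mv m c :
  (forall i, bumped incs decs (ctr m) i = c i) ->
  runs (Step (glide incs decs j mv)) m
    (Mem c (stk m) (ihd m)
      (at_head (mcfg m) j (cfg_head (mcfg m) j + move_offset mv)%R)) 1.
Proof.
move=> /funext <-; apply: runs_step => //.
rewrite /perform /= addr0; congr Mem; first by apply/funext; case.
rewrite /perform_sim /=; congr TMConfig; apply/funext => k.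
  by apply/funext => z; case: eqVneq => // ->; rewrite ffunE.
by case: eqVneq => [->|]; rewrite // addr0.
Qed.

(** [cFuel] receives N, and [cDouble] a copy to be consumed by the logarithm; [cLen] serves to bring
    the input head back. *)
Definition count_input (C : nat) : prog :=
  Seq (While (fun v => isSome (vin v))
         (Seq (Step (go [:: cLen] [::] MoveRight))
              (times C (Step (bumps [:: cFuel; cDouble] [::])))))
      (While (nonzero cLen) (Step (go [::] [:: cLen] MoveLeft))).

Definition count_ctr l f (c : counter) : nat :=
  match c with cLen => l | cFuel | cDouble => f | _ => 0 end.

Lemma onth_isSome (T : Type) (s : seq T) i : isSome (onth s i) = (i < size s).
Proof. by elim: s i => [|x s ih] [|i] //=. Qed.

Lemma runs_count_input C :
  runs (count_input C) (mem0 M)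
    (Mem (count_ctr 0 (C * size w)) [::] 0%R (mcfg (mem0 M)))
    (size w * (C + 5) + 2).
Proof.
set k0 := mcfg _; set l := size w.
pose st1 i := Mem (count_ctr i (C * i)) [::] (Posz i) k0.
pose st2 i := Mem (count_ctr (l - i) (C * l)) [::] (Posz l - Posz i)%R k0.
have -> : mem0 M = st1 0.
  by congr Mem; apply/funext; case; rewrite //= muln0.
have -> : Mem (count_ctr 0 (C * l)) [::] 0%R k0 = st2 l.
  by rewrite /st2 subnn subrr.
apply: (runs_seq (st1 l) (l * C.+3 + 1) (l * 2 + 1)); last by lia.
  apply: (runs_while st1 (n := l) (T := C.+2)) => [i hi|]; last first.
    by rewrite /= onth_isSome ltnn.
  rewrite /= onth_isSome; split=> //.
  pose st3 j := Mem (count_ctr i.+1 (C * i + j)) [::] (Posz i.+1) k0.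
  have -> : st1 i.+1 = st3 C by rewrite /st3 -mulnSr.
  apply: (runs_seq (st3 0) 1 (C * 1 + 1)); last by lia.
    have -> : st3 0 = Mem (count_ctr i.+1 (C * i)) [::]
        (ihd (st1 i) + move_offset MoveRight)%R k0.
      by rewrite /st3 addn0 /=; congr Mem; lia.
    by apply: (@runs_go _ _ _ (st1 i)); case.
  apply: (runs_times st3) => j hj.
  rewrite -[st3 j.+1]/(set_ctr (st3 j) (ctr (st3 j.+1))).
  by apply: runs_bumps; apply/funext; case; rewrite //= addnS.
have -> : st1 l = st2 0 by rewrite /st1 /st2 subn0 subr0.
apply: (runs_while st2) => [i hi|]; last first.
  by rewrite /nonzero /= subnn.
rewrite /nonzero /=; split; first by lia.
have -> : st2 i.+1 = Mem (count_ctr (l - i.+1) (C * l)) [::]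
    (ihd (st2 i) + move_offset MoveLeft)%R k0.
  by congr Mem; rewrite /=; lia.
by apply: (@runs_go _ _ _ (st2 i)); case => //=; rewrite /bumped /=; lia.
Qed.

(** A logarithm by doubling. After i rounds [cPow] is 2^i and 1 + 2 + ... + 2^(i-1) = 2^i - 1 has
    been subtracted from N in [cDouble], so that the loop ends at the first k with 2^k > N. Each
    round adds 2 to [cArg]. *)
Definition double_loop : prog :=
  Seq (Step (bumps [:: cPow] [::]))
 (Seq (While (nonzero cDouble)
        (Seq (moves [:: (cPow, [:: cTmp; cTmp2], [:: cDouble]);
                        (cTmp, [:: cPow], [::]); (cTmp2, [:: cPow], [::])])
        (Seq (Step (bumps [:: cArg] [::])) (Step (bumps [:: cArg] [::])))))
      (moves [:: (cPow, [::], [::])])).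

Definition double_ctr N p d a (c : counter) : nat :=
  match c with
  | cFuel => N | cPow => p | cDouble => d | cArg => a | _ => 0
  end.

Lemma runs_double_loop N m : ctr m = count_ctr 0 N ->
  let k := (trunc_log 2 N).+1 in 0 < N ->
  runs double_loop m (set_ctr m (double_ctr N 0 0 (2 * k))) (100 * N.+1 ^ 2).
Proof.
move=> hm k hN.
have /andP[h1 h2] : 2 ^ k.-1 <= N < 2 ^ k by apply: trunc_log_bounds.
have h3 : 2 ^ k <= 2 * N by rewrite expnS leq_pmul2l.
have hk : k <= N by apply: leq_trans h1; rewrite /k ltn_expl.
pose st i := set_ctr m (double_ctr N (2 ^ i) (N - (2 ^ i - 1)) (2 * i)).
apply: (runs_seq (st 0) 1 (k * (20 * N + 10).+1 + 1 + (4 * N + 2))).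
- apply: runs_bumps; rewrite hm; apply/funext; case => //=.
  by rewrite /bumped /= expn0 subnn subn0.
- apply: (runs_seq (st k) (k * (20 * N + 10).+1 + 1) (4 * N + 2)); last by lia.
    apply: (runs_while st) => [i hi|]; last by rewrite /nonzero /=; lia.
    have hi' : 2 ^ i <= N.
      by apply: leq_trans h1; rewrite leq_exp2l.
    rewrite /nonzero /=; split; first by lia.
    pose a := set_ctr m (double_ctr N (2 ^ i.+1) (N - (2 ^ i.+1 - 1)) (2 * i)).
    pose b := set_ctr m
      (double_ctr N (2 ^ i.+1) (N - (2 ^ i.+1 - 1)) (2 * i).+1).
    apply: (runs_seq a (20 * N + 8) 2); last by lia.
      apply: (runs_moves (st i) (ctr a)) => //; last first.
        by rewrite /= /moved /=; lia.
      by case; rewrite //= /moved /= ?expnS; lia.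
    apply: (runs_seq b 1 1) => //.
      by apply: (runs_bumps a); apply/funext; case.
    apply: (runs_bumps b); apply/funext; case => //=.
    by rewrite /bumped /=; lia.
  apply: (runs_moves (st k) (double_ctr N 0 0 (2 * k))) => //; last first.
    by rewrite /= /moved /=; lia.
  by case => //=; rewrite /moved /=; lia.
- nia.
Qed.

Definition put_one : view -> instr M := fun v =>
  Instr (counter_moves [:: cTmp] [:: cArg]) None Stay
    (Some (vstate v,
           [ffun j => if j == ord0 then Some (inl (Some true)) else vcells v j],
           fun j => if j == ord0 then MoveRight else Stay)).

Definition write_arg : prog :=
  Seq (While (nonzero cArg) (Step put_one))
      (While (nonzero cTmp) (Step (glide [::] [:: cTmp] ord0 MoveLeft))).

Definition sim_ctr N a t r l (c : counter) : nat :=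
  match c with
  | cFuel => N | cArg => a | cTmp => t | cRight => r | cLeft => l | _ => 0
  end.

Lemma onth_unary n k :
  onth (unary n) k = if k < n then Some (Some true) else None.
Proof. by elim: n k => [|n ih] [|k] //=; rewrite ih. Qed.

Lemma runs_write_arg N n :
  runs write_arg (Mem (sim_ctr N n 0 0 0) [::] 0%R (tm_init M [::]))
    (Mem (sim_ctr N 0 0 0 0) [::] 0%R (tm_init M (unary n))) (4 * n + 2).
Proof.
pose k i h := @TMConfig _ M (tm_start M)
  (fun j => tape_word M (if j == ord0 then unary i else [::]))
  (fun j => if j == ord0 then Posz h else 0%R).
pose st1 i := Mem (sim_ctr N (n - i) i 0 0) [::] 0%R (k i i).
pose st2 i := Mem (sim_ctr N 0 (n - i) 0 0) [::] 0%R (k n (n - i)).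
have hk0 i : k i 0 = tm_init M (unary i).
  by congr TMConfig; apply/funext => j; rewrite if_same.
have -> : Mem (sim_ctr N n 0 0 0) [::] 0%R (tm_init M [::]) = st1 0.
  by rewrite /st1 hk0 subn0.
have -> : Mem (sim_ctr N 0 0 0 0) [::] 0%R (tm_init M (unary n)) = st2 n.
  by rewrite /st2 subnn hk0.
apply: (runs_seq (st1 n) (n * 2 + 1) (n * 2 + 1)); last by lia.
  apply: (runs_while st1) => [i hi|]; last first.
    by rewrite /nonzero /= subnn.
  rewrite /nonzero /=; split; first by lia.
  apply: runs_step => //; rewrite /perform /= addr0; congr Mem.
    by apply/funext; case; rewrite //= /perform_ctr /counter_moves /=; lia.
  congr TMConfig; apply/funext => j; last first.
    by rewrite /=; case: (j == ord0) => /=; lia.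
  apply/funext => z; rewrite ffunE /= ffunE /=; case: (j == ord0) => /=.
    case: z => [z|z] //=; rewrite -[Some _ :: _]/(unary i.+1) !onth_unary ltnS.
    by rewrite -[(Posz z == _)]/(z == i) [z <= i]leq_eqVlt; case: eqVneq.
  by rewrite !tape_word_nil if_same.
have -> : st1 n = st2 0 by rewrite /st1 /st2 subnn subn0.
apply: (runs_while st2) => [i hi|]; last first.
  by rewrite /nonzero /= subnn.
rewrite /nonzero /=; split; first by lia.
have -> : st2 i.+1 = Mem (sim_ctr N 0 (n - i.+1) 0 0) [::] 0%R
    (at_head (mcfg (st2 i)) ord0
             (cfg_head (mcfg (st2 i)) ord0 + move_offset MoveLeft)%R).
  congr Mem; congr TMConfig; apply/funext => j /=.
  by case: (j == ord0) => //=; lia.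
by apply: (@runs_glide _ _ _ _ (st2 i)); case => //=; rewrite /bumped /=; lia.
Qed.

Definition sim_step : view -> instr M := fun v =>
  if tm_delta (vstate v) (vcells v) is Some (q, wr, mv) then
    Instr (fun c => match c, mv ord_max with
                    | cRight, MoveRight | cLeft, MoveLeft => MoveRight
                    | _, _ => Stay
                    end) None Stay (Some (q, wr, mv))
  else idle M.

(* The moves of the last head are recorded, so as to find the output again. *)
Definition run_sim : prog :=
  Seq (While (fun v => isSome (tm_delta (vstate v) (vcells v))) (Step sim_step))
 (Seq (While (nonzero cRight) (Step (glide [::] [:: cRight] ord_max MoveLeft)))
      (While (nonzero cLeft) (Step (glide [::] [:: cLeft] ord_max MoveRight)))).

Fixpoint count_moves (f : tm_move -> nat) u t : nat :=
  if t is t'.+1 then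
    count_moves f u t' +
    (if tm_action (tm_run M u t') is Some (_, _, mv) then f (mv ord_max) else 0)
  else 0.

Definition is_right (mv : tm_move) : nat := if mv is MoveRight then 1 else 0.
Definition is_left (mv : tm_move) : nat := if mv is MoveLeft then 1 else 0.

Lemma count_moves_le u t :
  count_moves is_right u t + count_moves is_left u t <= t.
Proof.
elim: t => //= t ih; case: (tm_action _) => [[[q wr] mv]|]; last by lia.
by case: (mv ord_max) => /=; lia.
Qed.

Lemma count_moves_head u t : cfg_head (tm_run M u t) ord_max =
  (Posz (count_moves is_right u t) - Posz (count_moves is_left u t))%R.
Proof.
elim: t => //= t ih; rewrite /tm_next; case: (tm_action _) => [[[q wr] mv]|] /=.
  by rewrite ih; case: (mv ord_max) => /=; lia.
by rewrite ih; lia.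
Qed.

Lemma tm_run_halted u t d :
  tm_halted (tm_run M u t) -> tm_run M u (t + d) = tm_run M u t.
Proof.
move=> h; elim: d => [|d ih]; first by rewrite addn0.
rewrite addnS [LHS]/(tm_next (tm_run M u (t + d))) ih /tm_next.
by move: h; rewrite /tm_halted; case: (tm_action _).
Qed.

(** [tm_outputs] tolerates idle steps after halting, whereas the simulation loop ends at the first
    halting configuration. *)
Lemma first_halt u t : tm_halted (tm_run M u t) ->
  exists t', [/\ t' <= t, tm_halted (tm_run M u t'),
    tm_run M u t' = tm_run M u t &
    forall i, i < t' -> ~~ tm_halted (tm_run M u i)].
Proof.
move=> ht; have ex : exists i, tm_halted (tm_run M u i) by exists t.
case: (ex_minnP ex) => i hi hmin; exists i.
have hit : i <= t by apply: hmin.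
split => //; first by rewrite -(subnKC hit) tm_run_halted.
by move=> j; apply: contraLR; rewrite negbK -leqNgt; apply: hmin.
Qed.

Lemma runs_run_sim N u v t : tm_outputs M u v t ->
  exists2 k : tm_config M,
    cfg_head k ord_max = 0%R /\ cfg_tape k ord_max = tape_word M v &
    runs run_sim (Mem (sim_ctr N 0 0 0 0) [::] 0%R (tm_init M u))
      (Mem (sim_ctr N 0 0 0 0) [::] 0%R k) (4 * t + 3).
Proof.
case=> /first_halt[t' [ht' hh htt hlt]]; rewrite -htt => hv.
pose r := count_moves is_right u; pose l := count_moves is_left u.
have hrl : r t' + l t' <= t' := count_moves_le u t'.
(* From here on only the output of [M] matters, so that only its last head is rewound. *)
pose k i j := at_head (tm_run M u t') ord_max (Posz i - Posz j)%R.
exists (k 0 0); first by split; [rewrite /= eqxx | apply/funext].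
pose st1 i := Mem (sim_ctr N 0 0 (r i) (l i)) [::] 0%R (tm_run M u i).
pose st2 i := Mem (sim_ctr N 0 0 (r t' - i) (l t')) [::] 0%R
                  (k (r t' - i) (l t')).
pose st3 i := Mem (sim_ctr N 0 0 0 (l t' - i)) [::] 0%R (k 0 (l t' - i)).
have -> : Mem (sim_ctr N 0 0 0 0) [::] 0%R (k 0 0) = st3 (l t').
  by rewrite /st3 subnn.
apply: (runs_seq (st1 t') (t' * 2 + 1) (r t' * 2 + l t' * 2 + 2)).
- apply: (runs_while st1) => [i hi|]; last by apply: hh.
  move/hlt: hi; rewrite /tm_halted negbK => hi; split=> //.
  have hact : tm_delta (vstate (look (st1 i))) (vcells (look (st1 i))) =
    tm_action (tm_run M u i) by [].
  have hnext : tm_run M u i.+1 = tm_next (tm_run M u i) by [].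
  apply: runs_step; rewrite /sim_step hact.
    by case: (tm_action _) hi => // [[[q wr] mv]].
  rewrite /st1 hnext /tm_next /r /l /=.
  case: (tm_action _) hi => // [[[q wr] mv]] _; rewrite /perform /= addr0.
  congr Mem; apply/funext; case; rewrite //= /perform_ctr /=.
  + by case: (mv ord_max); rewrite /= ?addn0 ?addn1.
  + by case: (mv ord_max); rewrite /= ?addn0 ?addn1.
- have -> : st1 t' = st2 0.
    rewrite /st1 /st2 subn0; congr Mem; rewrite /k -count_moves_head.
    case: (tm_run M u t') => q tp hd; congr TMConfig; apply/funext => j /=.
    by case: eqVneq => // ->.
  apply: (runs_seq (st2 (r t')) (r t' * 2 + 1) (l t' * 2 + 1)).
  + apply: (runs_while st2) => [i hi|]; last first.
      by rewrite /nonzero /= subnn.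
    rewrite /nonzero /=; split; first by lia.
    have -> : st2 i.+1 = Mem (ctr (st2 i.+1)) [::] 0%R
       (at_head (mcfg (st2 i)) ord_max
         (cfg_head (mcfg (st2 i)) ord_max + move_offset MoveLeft)%R).
      congr Mem; congr TMConfig; apply/funext => j /=.
      by rewrite eqxx; case: (j == ord_max) => //=; lia.
    by apply: (@runs_glide _ _ _ _ (st2 i)); case=> //=;
      rewrite /bumped /=; lia.
  + have -> : st2 (r t') = st3 0 by rewrite /st2 /st3 subnn subn0.
    apply: (runs_while st3) => [i hi|]; last first.
      by rewrite /nonzero /= subnn.
    rewrite /nonzero /=; split; first by lia.
    have -> : st3 i.+1 = Mem (ctr (st3 i.+1)) [::] 0%R
       (at_head (mcfg (st3 i)) ord_max
         (cfg_head (mcfg (st3 i)) ord_max + move_offset MoveRight)%R).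
      congr Mem; congr TMConfig; apply/funext => j /=.
      by rewrite eqxx; case: (j == ord_max) => //=; lia.
    by apply: (@runs_glide _ _ _ _ (st3 i)); case=> //=;
      rewrite /bumped /=; lia.
  + by lia.
- by lia.
Qed.

End Preparation.

(** * The continued fraction walk *)

(* The fractions xp / xq and yp / yq are consecutive (semi)convergents. *)
Record walk := Walk { xp : nat; xq : nat; yp : nat; yq : nat }.

(** Adding the formal fraction 1/0 would raise [xp] but not [xq], and would never exhaust the bound
    N; hence the guard on [yq]. *)
Definition wstep N (s : walk) : walk :=
  if (0 < yq s) && (xq s + yq s <= N)
  then Walk (xp s + yp s) (xq s + yq s) (yp s) (yq s) else s.

Definition wswap (s : walk) : walk := Walk (yp s) (yq s) (xp s) (xq s).

(** Each effective step raises the sum of the denominators by at least 1, so that a quotient larger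
    than this number acts like this number. *)
Definition fuel N (s : walk) : nat := N.+1 - (xq s + yq s).

(* Having read the leading bits of a partial quotient a, the machine stores
   [fuel N s - a], which is all that is needed of a. *)
Definition read_symbol N (a : walk * nat) (x : option bool) : walk * nat :=
  let: (s, u) := a in
  match x with
  | Some b => (s, 2 * u - fuel N s - b)
  | None => let s' := wswap (iter (fuel N s - u) (wstep N) s) in (s', fuel N s')
  end.

(** Bounds that hold whatever [M] has written; they make all counters linear in N. A step is taken
    only from a sum at most N and at most doubles it; the [+ 1] covers the initial sum 1. The
    exceptions for a zero denominator admit the formal fraction 1/0. *)
Definition wgood N (s : walk) : bool :=
  [&& xq s + yq s <= 2 * N + 1, xp s <= xq s + (xq s == 0),
      yp s <= yq s + (yq s == 0), (xq s == 0) ==> (yp s == 0),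
      (yq s == 0) ==> (xp s == 0) & 0 < xq s + yq s].

Lemma wgood_step N s : wgood N s -> wgood N (wstep N s).
Proof.
rewrite /wgood /wstep; case: s => a b c d /=; case: ifP => //= /andP[hd hN].
by case: eqVneq; case: (eqVneq d); case: (eqVneq (b + d)) => /=; lia.
Qed.

Lemma wgood_iter N n s : wgood N s -> wgood N (iter n (wstep N) s).
Proof. by move=> hs; elim: n => //= n ih; apply: wgood_step. Qed.

Lemma wgood_swap N s : wgood N s -> wgood N (wswap s).
Proof. by rewrite /wgood; case: s => a b c d /= /and5P[? ? ? ? ?]; lia. Qed.

Section Reading.
Variables (S : finType) (M : turing_machine (option bool)) (w : seq S).

Local Notation mem := (mem M).
Local Notation view := (view S M).
Local Notation prog := (prog S M).
Local Notation look := (look w).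
Local Notation runs := (@runs S M w).

Definition walk_step : prog :=
  If (fun v => ~~ vzero v cFuel && ~~ vzero v cYq)
     (moves [:: (cYp, [:: cXp; cTmp], [::]); (cTmp, [:: cYp], [::]);
                (cYq, [:: cXq; cTmp], [:: cFuel]); (cTmp, [:: cYq], [::])])
     (Step (fun=> idle M)).

Definition end_quotient : prog :=
  Seq (moves [:: (cFuel, [:: cTimes; cTmp], [::]); (cTmp, [:: cFuel], [::]);
                 (cRest, [::], [:: cTimes])])
 (Seq (While (nonzero cTimes)
        (Seq (Step (bumps [::] [:: cTimes])) walk_step))
 (Seq (moves [:: (cXp, [:: cTmp], [::]); (cYp, [:: cXp], [::]);
                 (cTmp, [:: cYp], [::])])
 (Seq (moves [:: (cXq, [:: cTmp], [::]); (cYq, [:: cXq], [::]);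
                 (cTmp, [:: cYq], [::])])
      (moves [:: (cFuel, [:: cRest; cTmp], [::]); (cTmp, [:: cFuel], [::])])))).

Definition read_bit : prog :=
  Seq (moves [:: (cRest, [:: cTmp; cTmp2], [::]); (cTmp, [:: cRest], [::]);
                 (cTmp2, [:: cRest], [::]); (cFuel, [:: cTmp], [:: cRest]);
                 (cTmp, [:: cFuel], [::])])
      (If (fun v => vcells v ord_max == Some (inl (Some true)))
          (Step (bumps [::] [:: cRest])) (Step (fun=> idle M))).

Definition read_quotients : prog :=
  While (fun v => isSome (vcells v ord_max))
    (Seq (If (fun v => vcells v ord_max == Some (inl None))
             end_quotient read_bit)
         (Step (glide [::] [::] ord_max MoveRight))).

Definition walk_ctr N t (a : walk * nat) (c : counter) : nat :=
  match c with
  | cXp => xp a.1 | cXq => xq a.1 | cYp => yp a.1 | cYq => yq a.1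
  | cFuel => fuel N a.1 | cRest => a.2 | cTimes => t | _ => 0
  end.

Lemma runs_walk_step N t s m : wgood N s ->
  ctr m = walk_ctr N t (s, 0) ->
  runs walk_step m (set_ctr m (walk_ctr N t (wstep N s, 0))) (20 * N + 30).
Proof.
move=> /and5P[h1 h2 h3 h4 /andP[h5 h6]] hm.
apply: (@runs_le _ _ _ _ _ _ (20 * N + 29).+1); last by lia.
apply: runs_if; rewrite /= hm /=.
have hg : (fuel N s != 0) && (yq s != 0) = (0 < yq s) && (xq s + yq s <= N).
  by rewrite /fuel; lia.
rewrite hg /wstep; case hs: (_ && _).
  apply: runs_moves => //; rewrite hm; last by rewrite /= /moved /=; lia.
  by case; rewrite //= /moved /= /fuel /=; lia.
apply: (@runs_le _ _ _ _ _ _ 1); last by lia.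
apply: runs_step => //.
by rewrite perform_idle -hm; case: (m).
Qed.

Lemma runs_end_quotient N a m : wgood N a.1 -> a.2 <= fuel N a.1 ->
  ctr m = walk_ctr N 0 a ->
  runs end_quotient m (set_ctr m (walk_ctr N 0 (read_symbol N a None)))
    (200 * N.+1 ^ 2).
Proof.
case: a => s u /= hs hu hm; set v := fuel N s - u.
have hf : fuel N s <= N.+1 by rewrite /fuel; lia.
have hv : v <= N.+1 by lia.
pose st i := set_ctr m (walk_ctr N (v - i) (iter i (wstep N) s, 0)).
apply: (runs_seq (st 0) (10 * N + 20)
          (v * (20 * N + 31).+1 + 1 + (100 * N + 100))); last by nia.
  apply: (runs_moves m (ctr (st 0))) => //; rewrite hm.
    by case; rewrite //= /moved /=; lia.
  by rewrite /= /moved /=; lia.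
apply: (runs_seq (st v) (v * (20 * N + 31).+1 + 1) (100 * N + 100)) => //.
  apply: (runs_while st) => [i hi|]; last by rewrite /nonzero /= subnn.
  rewrite /nonzero /=; split; first by lia.
  pose b := set_ctr m (walk_ctr N (v - i.+1) (iter i (wstep N) s, 0)).
  apply: (runs_seq b 1 (20 * N + 30)); last by lia.
    apply: (runs_bumps (st i)); apply/funext; case => //=.
    by rewrite /bumped /=; lia.
  by apply: (@runs_walk_step N _ _ b) => //; apply: wgood_iter.
have := wgood_iter v hs; rewrite /st subnn.
case: (iter v (wstep N) s) => p q p' q' /= /and5P[/= h1 h2 h3 _ _].
have hp : p <= q.+1 by apply: leq_trans h2 _; case: (q == 0); lia.
have hp' : p' <= q'.+1 by apply: leq_trans h3 _; case: (q' == 0); lia.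
pose mp := set_ctr m (walk_ctr N 0 (Walk p' q p q', 0)).
pose mq := set_ctr m (walk_ctr N 0 (Walk p' q' p q, 0)).
apply: (runs_seq mp (20 * N + 20) (40 * N + 40)); last by lia.
  apply: (runs_moves (set_ctr m _) (ctr mp)) => //; last first.
    by rewrite /= /moved /=; lia.
  by case; rewrite //= /moved /=; lia.
apply: (runs_seq mq (20 * N + 20) (20 * N + 20)); last by lia.
  apply: (runs_moves mp (ctr mq)) => //; last by rewrite /= /moved /=; lia.
  by case; rewrite //= /moved /= /fuel /=; lia.
apply: (runs_moves mq) => //; last by rewrite /= /moved /= /fuel /=; lia.
by case; rewrite //= /moved /= /fuel /=; lia.
Qed.

Lemma runs_read_bit N a b m : wgood N a.1 -> a.2 <= fuel N a.1 ->
  ctr m = walk_ctr N 0 a -> vcells (look m) ord_max = Some (inl (Some b)) ->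
  runs read_bit m (set_ctr m (walk_ctr N 0 (read_symbol N a (Some b))))
    (200 * N.+1 ^ 2).
Proof.
case: a => s u /= hs hu hm hb.
have hf : fuel N s <= N.+1 by rewrite /fuel; lia.
pose m1 := set_ctr m (walk_ctr N 0 (s, 2 * u - fuel N s)).
apply: (runs_seq m1 (20 * N + 40) 2); last by nia.
  apply: runs_moves; rewrite ?hm //=; last by rewrite /moved /=; lia.
  by case; rewrite //= /moved /=; lia.
apply: runs_if; rewrite /= in hb *; rewrite hb.
case: b {hb} => /=.
  apply: (runs_bumps m1); apply/funext; case => //=.
  by rewrite /bumped /=; lia.
by apply: runs_step => //; rewrite perform_idle subn0.
Qed.

Lemma runs_read_quotients N (v : seq (option bool)) k a h :
  wgood N a.1 -> a.2 <= fuel N a.1 ->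
  cfg_head k ord_max = 0%R -> cfg_tape k ord_max = tape_word M v ->
  exists k', runs read_quotients (Mem (walk_ctr N 0 a) [::] h k)
    (Mem (walk_ctr N 0 (foldl (read_symbol N) a v)) [::] h k')
    (size v * (200 * N.+1 ^ 2 + 2).+1 + 1).
Proof.
move=> hs hu hk hv.
pose st i a := Mem (walk_ctr N 0 a) [::] h (at_head k ord_max (Posz i)).
exists (at_head k ord_max (Posz (size v))).
have -> : Mem (walk_ctr N 0 a) [::] h k = st 0 a.
  congr Mem; case: k hk {hv st} => q t d hk; congr TMConfig.
  by apply/funext => j; case: eqVneq => //= ->.
apply: (@runs_while_word _ _ _ _ _ v (read_symbol N)
  (fun a _ => wgood N a.1 && (a.2 <= fuel N a.1)) st).
- by rewrite hs.
- move=> i [s u] x r hx /andP[/= hs' hu'].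
  have hc c l : vcells (look (Mem c l h (at_head k ord_max (Posz i)))) ord_max
      = Some (inl x).
    by rewrite /= ffunE eqxx hv /= hx.
  split; first by have := hc (walk_ctr N 0 (s, u)) [::]; rewrite /= => ->.
    case: x {hx hc} => [b|] /=; first by rewrite hs'; lia.
    by rewrite leqnn andbT; apply: wgood_swap; apply: wgood_iter.
  pose m1 := st i (read_symbol N (s, u) x).
  apply: (runs_seq m1 (200 * N.+1 ^ 2).+1 1); last by lia.
    apply: runs_if; rewrite hc; case: x hx hc @m1 => [b|] hx hc m1 /=.
      exact: (@runs_read_bit N (s, u) b (st i (s, u)) hs' hu' erefl (hc _ _)).
    exact: (@runs_end_quotient N (s, u) (st i (s, u)) hs' hu' erefl).
  have -> : st i.+1 (read_symbol N (s, u) x) =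
      Mem (ctr m1) [::] h (at_head (mcfg m1) ord_max
        (cfg_head (mcfg m1) ord_max + move_offset MoveRight)%R).
    congr Mem; congr TMConfig; apply/funext => j /=.
    by rewrite eqxx; case: (j == ord_max) => //=; lia.
  by apply: (@runs_glide _ _ _ _ _ _ _ m1); case.
- by move=> a' _; rewrite /= ffunE eqxx hv /=; have := onth_isSome v (size v);
  rewrite ltnn; case: onth.
Qed.

End Reading.

(** * Evaluating formulas *)

(** With truncated subtraction [q - (q - z)] is the minimum of [z] and [q]. The machine computes it
    in this form, by two complements. *)
Fixpoint chain_value (q g : nat) (phi : formula) : nat :=
  match phi with
  | FZero => 0
  | FX => g
  | FStar phi => q - chain_value q g phi
  | FOplus phi psi => q - (q - (chain_value q g phi + chain_value q g psi))
  end.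

(* Read from left to right, a formula is its own reverse Polish form as soon as
   left parentheses and occurrences of [SOplus] are skipped. *)
Definition eval_symbol (q g : nat) (a : nat * seq nat) (x : option fsymbol) :=
  match x with
  | Some SZero => (0, a.1 :: a.2)
  | Some SX => (g, a.1 :: a.2)
  | Some SStar => (q - a.1, a.2)
  | Some SRpar => (q - (q - (a.1 + head 0 a.2)), behead a.2)
  | _ => a
  end.

(** [d] is the number of entries below the top of the stack; [SRpar] is the only symbol that
    consumes one. *)
Fixpoint no_underflow (d : nat) (u : seq (option fsymbol)) : bool :=
  if u is x :: u' then
    match x with
    | Some SZero | Some SX => no_underflow d.+1 u'
    | Some SRpar => (0 < d) && no_underflow d.-1 u'
    | _ => no_underflow d u'
    end
  else true.

Lemma no_underflow_formula phi d u :
  no_underflow d (map Some (fstring phi) ++ u) = no_underflow d.+1 u.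
Proof.
elim: phi d u => //= [phi ih|phi ihp psi ihq] d u.
  by rewrite map_rcons cat_rcons ih.
by rewrite map_cat /= map_rcons -catA ihp /= cat_rcons ihq.
Qed.

Lemma eval_formula q g phi a : 
  foldl (eval_symbol q g) a (map Some (fstring phi)) =
  (chain_value q g phi, a.1 :: a.2).
Proof.
elim: phi a => //= [phi ih|phi ihp psi ihq] a.
  by rewrite map_rcons foldl_rcons ih.
rewrite map_cat /= map_rcons foldl_cat ihp /= foldl_rcons ihq /=.
by rewrite [_ + chain_value _ _ phi]addnC.
Qed.

Lemma chain_value_le q g phi : g <= q -> chain_value q g phi <= q.
Proof. by move=> hg; case: phi => //= *; apply: leq_subr. Qed.

Section Evaluation.
Variables (M : turing_machine (option bool)) (w : seq (option fsymbol)).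

Local Notation S := (option fsymbol).
Local Notation mem := (mem M).
Local Notation view := (view S M).
Local Notation prog := (prog S M).
Local Notation look := (look w).
Local Notation runs := (@runs S M w).

Definition eval_ctr p q g v a b t (c : counter) : nat :=
  match c with
  | cYp => p | cYq => q | cGen => g | cStk => v | cA => a | cB => b
  | cTmp => t | _ => 0
  end.

Definition close_walk : prog :=
  moves [:: (cXp, [:: cYp], [::]); (cXq, [:: cYq], [::]); (cRest, [::], [::]);
            (cFuel, [::], [::])].

Lemma runs_close_walk N a m : wgood N a.1 -> a.2 <= fuel N a.1 ->
  ctr m = walk_ctr N 0 a ->
  runs close_walk m (set_ctr m (eval_ctr (xp a.1 + yp a.1) (xq a.1 + yq a.1)
                                         0 0 0 0 0)) (20 * N + 40).
Proof.
case: a => s u /= /and5P[h1 h2 h3 h4 /andP[h5 h6]] hu hm.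
have hf : fuel N s <= N.+1 by rewrite /fuel; lia.
apply: runs_moves => //; rewrite hm; last by rewrite /= /moved /=; lia.
by case; rewrite //= /moved /=; lia.
Qed.

Definition add_gen (c : counter) : prog :=
  moves [:: (c, [:: cGen; cTmp], [::]); (cTmp, [:: c], [::])].

Definition sub_gen (c : counter) : prog :=
  moves [:: (c, [:: cTmp], [:: cGen]); (cTmp, [:: c], [::])].

(** All additions precede the subtractions, so that truncation loses nothing as soon as the final
    value is nonnegative. *)
Definition set_gen (a a' b b' : nat) : prog :=
  Seq (times a (add_gen cYq)) (Seq (times b (add_gen cYp))
 (Seq (times a' (sub_gen cYq)) (times b' (sub_gen cYp)))).

Lemma runs_set_gen p q a a' b b' m : p <= q ->
  ctr m = eval_ctr p q 0 0 0 0 0 ->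
  runs (set_gen a a' b b') m
    (set_ctr m (eval_ctr p q (a * q + b * p - a' * q - b' * p) 0 0 0 0))
    ((a + a' + b + b') * (4 * q + 3) + 4).
Proof.
move=> hpq hm.
pose st g := set_ctr m (eval_ctr p q g 0 0 0 0).
have hadd c x g n : c = cYq /\ x = q \/ c = cYp /\ x = p ->
    runs (times n (add_gen c)) (st g) (st (g + n * x)) (n * (4 * q + 3) + 1).
  move=> hc; have h g' : runs (add_gen c) (st g') (st (g' + x)) (4 * q + 3).
    by case: hc => -[-> ->]; apply: (runs_moves (st _) (ctr (st _)));
      rewrite //= /moved /=; first [case | lia]; rewrite //= /moved /=; lia.
  pose st' i := st (g + i * x); rewrite (_ : st g = st' 0).
    by apply: (runs_times st') => i _; rewrite /st' mulSnr addnA.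
  by rewrite /st' addn0.
have hsub c x g n : c = cYq /\ x = q \/ c = cYp /\ x = p ->
    runs (times n (sub_gen c)) (st g) (st (g - n * x)) (n * (4 * q + 3) + 1).
  move=> hc; have h g' : runs (sub_gen c) (st g') (st (g' - x)) (4 * q + 3).
    by case: hc => -[-> ->]; apply: (runs_moves (st _) (ctr (st _)));
      rewrite //= /moved /=; first [case | lia]; rewrite //= /moved /=; lia.
  pose st' i := st (g - i * x); rewrite (_ : st g = st' 0).
    by apply: (runs_times st') => i _; rewrite /st' mulSnr subnDA.
  by rewrite /st' subn0.
have hm0 : m = st 0 by rewrite /st /set_ctr -hm; case: (m).
rewrite {1}hm0.
have hq : cYq = cYq /\ q = q \/ cYq = cYp /\ q = p by left.
have hp : cYp = cYq /\ p = q \/ cYp = cYp /\ p = p by right.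
apply: (runs_seq _ _ _ (hadd _ _ _ _ hq) (runs_seq _ _ _ (hadd _ _ _ _ hp)
  (runs_seq _ _ _ (hsub _ _ _ _ hq) (hsub _ _ _ _ hp) (leqnn _)) (leqnn _))).
by lia.
Qed.

Definition push : prog :=
  Seq (Step (bumps [:: cStk] [::]))
      (Step (fun=> Instr (fun=> Stay) (Some true) Stay None)).

Definition pop : prog :=
  Step (fun=> Instr (fun=> Stay) (Some false) Stay None).

Definition complement : prog :=
  moves [:: (cStk, [:: cA], [::]); (cYq, [:: cStk; cTmp], [::]);
            (cTmp, [:: cYq], [::]); (cA, [::], [:: cStk])].

Definition add_top : prog :=
  Seq (moves [:: (cStk, [:: cA], [::])])
 (Seq pop (Seq complement complement)).

Definition push_gen : prog :=
  Seq push (moves [:: (cGen, [:: cStk; cTmp], [::]); (cTmp, [:: cGen], [::])]).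

Definition is_symbol (x : fsymbol) : view -> bool :=
  fun v => match vin v, x with
           | Some (Some SZero), SZero | Some (Some SX), SX
           | Some (Some SStar), SStar | Some (Some SRpar), SRpar => true
           | _, _ => false
           end.

Definition eval_step : prog :=
  If (is_symbol SZero) push
 (If (is_symbol SX) push_gen
 (If (is_symbol SStar) complement
 (If (is_symbol SRpar) add_top (Step (fun=> idle M))))).

Definition eval_input : prog :=
  While (fun v => isSome (vin v))
    (Seq eval_step (Step (go [::] [::] MoveRight))).

Lemma runs_push p q g v a b t r h k :
  runs push (Mem (eval_ctr p q g v a b t) r h k)
    (Mem (eval_ctr p q g 0 a b t) (v :: r) h k) 2.
Proof.
pose m := Mem (eval_ctr p q g v.+1 a b t) r h k.
apply: (runs_seq m 1 1) => //.
  by apply: (runs_bumps (Mem _ r h k)); apply/funext; case.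
apply: runs_step => //; rewrite /perform /= addr0; congr Mem.
by apply/funext; case.
Qed.

Lemma runs_pop p q g a b t v r h k :
  runs pop (Mem (eval_ctr p q g 0 a b t) (v :: r) h k)
    (Mem (eval_ctr p q g v a b t) r h k) 1.
Proof.
apply: runs_step => //; rewrite /perform /= addr0; congr Mem.
by apply/funext; case.
Qed.

Lemma runs_complement p q g v a r h k : v <= q -> a <= q ->
  runs complement (Mem (eval_ctr p q g v a 0 0) r h k)
    (Mem (eval_ctr p q g (q - (a + v)) 0 0 0) r h k) (10 * q + 6).
Proof.
move=> hv ha.
apply: (runs_moves (Mem _ r h k) (eval_ctr _ _ _ _ _ _ _)) => //=; last first.
  by rewrite /moved /=; lia.
by case; rewrite //= /moved /=; lia.
Qed.

Lemma runs_add_top p q g v u r h k : v <= q -> u <= q ->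
  runs add_top (Mem (eval_ctr p q g v 0 0 0) (u :: r) h k)
    (Mem (eval_ctr p q g (q - (q - (v + u))) 0 0 0) r h k) (30 * q + 20).
Proof.
move=> hv hu; pose m1 := Mem (eval_ctr p q g 0 v 0 0) (u :: r) h k.
apply: (runs_seq m1 (2 * q + 2) (1 + (20 * q + 12))); last by lia.
  apply: (runs_moves (Mem _ _ h k) (eval_ctr _ _ _ _ _ _ _)) => //=; last first.
    by lia.
  by case; rewrite //= /moved /=; lia.
apply: (runs_seq _ 1 (20 * q + 12) (runs_pop p q g v 0 0 u r h k)) => //.
apply: (runs_seq _ _ (10 * q + 6) (runs_complement p g r h k hu hv));
  last by lia.
have := @runs_complement p q g (q - (v + u)) 0 r h k (leq_subr _ _) isT.
by rewrite add0n => hr; apply: runs_le hr _; lia.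
Qed.

Lemma runs_eval_step p q g a x r k i : g <= q -> onth w i = Some x ->
  a.1 <= q -> all (fun v => v <= q) a.2 -> no_underflow (size a.2) (x :: r) ->
  runs eval_step (Mem (eval_ctr p q g a.1 0 0 0) a.2 (Posz i) k)
    (Mem (eval_ctr p q g (eval_symbol q g a x).1 0 0 0)
         (eval_symbol q g a x).2 (Posz i) k) (30 * q + 40).
Proof.
case: a => v s /= hg hx hv hs hr.
have hin m : ihd m = i -> vin (look m) = Some x by move=> hm; rewrite /= hm.
apply: (@runs_le _ _ _ _ _ _ (30 * q + 36).+4); last by lia.
have hsym y m : ihd m = i -> is_symbol y (look m) =
   match x, y with
   | Some SZero, SZero | Some SX, SX | Some SStar, SStar
   | Some SRpar, SRpar => true
   | _, _ => false end.
  by move=> hm; rewrite /is_symbol hin.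
have hidle m : runs (Step (fun=> idle M)) m m (30 * q + 36).
  apply: (@runs_le _ _ _ _ _ _ 1); last by lia.
  by apply: runs_step => //; rewrite perform_idle.
case: x hx hin hsym hr => [[]|] hx hin hsym /= hr.
- apply: runs_if; rewrite hsym //=.
  by apply: runs_le (runs_push _ _ _ _ _ _ _ _ _ _) _; lia.
- do 2![apply: runs_if; rewrite hsym //=].
  pose m1 := Mem (eval_ctr p q g 0 0 0 0) (v :: s) (Posz i) k.
  apply: (runs_seq m1 2 (4 * q + 3)); last by lia.
    exact: runs_push.
  apply: (runs_moves m1 (eval_ctr p q g g 0 0 0)) => //=.
    by case; rewrite //= /moved /=; lia.
  by rewrite /moved /=; lia.
- do 3![apply: runs_if; rewrite hsym //=].
  by apply: runs_le (runs_complement _ _ _ _ _ hv _) _; lia.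
- by do 4![apply: runs_if; rewrite hsym //=].
- by do 4![apply: runs_if; rewrite hsym //=].
- do 4![apply: runs_if; rewrite hsym //=].
  case: s hs hr => // u s /andP[hu _] _.
  by apply: runs_le (runs_add_top _ _ _ _ _ hv hu) _; lia.
- by do 4![apply: runs_if; rewrite hsym //=].
Qed.

Lemma runs_eval_input p q g k : g <= q -> no_underflow 0 w ->
  runs eval_input (Mem (eval_ctr p q g 0 0 0 0) [::] 0%R k)
    (let a := foldl (eval_symbol q g) (0, [::]) w in
     Mem (eval_ctr p q g a.1 0 0 0) a.2 (Posz (size w)) k)
    (size w * (30 * q + 42).+1 + 1).
Proof.
move=> hg hw.
pose st i (a : nat * seq nat) := Mem (eval_ctr p q g a.1 0 0 0) a.2 (Posz i) k.
pose Inv (a : nat * seq nat) u :=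
  [/\ a.1 <= q, all (fun v => v <= q) a.2 & no_underflow (size a.2) u].
apply: (@runs_while_word _ _ _ _ _ w (eval_symbol q g) Inv st _ _ _ (0, [::])).
- by split.
- move=> i [v s] x r hx [/= hv hs hr]; split; first by rewrite /= hx.
    case: x {hx} hr => [[]|] hr; split=> //=; rewrite /= ?hv ?leq_subr //.
    + by case: (s) hs => //= u s' /andP[].
    + by case: (s) hr.
  pose m1 := Mem (eval_ctr p q g (eval_symbol q g (v, s) x).1 0 0 0)
    (eval_symbol q g (v, s) x).2 (Posz i) k.
  apply: (runs_seq m1 (30 * q + 40) 1); last by lia.
    exact: (@runs_eval_step p q g (v, s) x r).
  rewrite /st intS addrC.
  by apply: (@runs_go _ _ _ _ _ _ m1); case.
- by move=> a _; rewrite /= onth_isSome ltnn.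
Qed.

End Evaluation.

(** * The decision program *)

(** The running time is the only control over the length of the output of [M], which has to be
    bounded because every symbol of it is read. *)
Lemma tm_run_bounded (S : finType) (M : turing_machine S) u t i :
  (cfg_head (tm_run M u t) i <= Posz t)%R /\
  forall k, size u + t <= k -> cfg_tape (tm_run M u t) i (Posz k) = None.
Proof.
elim: t => [|t [ih1 ih2]] /=.
  split=> // k; rewrite addn0 => hk; case: ifP => _ /=.
    have := onth_isSome u k; rewrite ltnNge hk.
    by case: (onth u k).
  by case: k {hk}.
rewrite /tm_next; case: (tm_action _) => [[[q wr] mv]|] /=; last first.
  by split=> [|k hk]; [lia | apply: ih2; lia].
split=> [|k hk]; first by case: (mv i) => /=; lia.
rewrite ifF; first by apply: ih2; lia.
by apply/eqP => hk'; move: ih1; rewrite -hk' lez_nat; lia.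
Qed.

Lemma size_output (S : finType) (M : turing_machine S) u v t :
  tm_outputs M u v t -> size v <= size u + t.
Proof.
move=> [_ hv]; rewrite leqNgt; apply/negP => hlt.
have [_ /(_ _ (leqnn _))] := @tm_run_bounded S M u t ord_max.
by rewrite hv /=; move: hlt; rewrite -onth_isSome; case: onth.
Qed.

(** The dominant term is the reading of the output of [M]: at most 2k + t symbols, each at a cost
    quadratic in N. *)
Lemma cost_bound N C e k t d sw sv q :
  sw <= N -> C <= e -> k <= N -> d <= e -> sv <= 2 * k + t -> q <= 2 * N + 1 ->
  sw * (C + 5) + 2 + (100 * N.+1 ^ 2 + (4 * (2 * k) + 2 + (4 * t + 3 +
    (4 * N + 4 + (sv * (200 * N.+1 ^ 2 + 2).+1 + 1 + (20 * N + 40 +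
    (d * (4 * q + 3) + 4 + (sw * (30 * q + 42).+1 + 1 + (10 * q + 10)))))))))
  <= (1000 + 20 * e) * N.+1 ^ 3 * t.+1.
Proof.
move=> hsw hC hk hd hsv hq; pose X := N.+1; pose W := X ^ 2; pose Z := X ^ 3.
rewrite -[N.+1]/X -[X ^ 2]/W -[X ^ 3]/Z.
have h1 : sw * (C + 5) <= X * (e + 5) by apply: leq_mul; lia.
have h2 : sv * (200 * W + 2).+1 <= (2 * X + t) * (200 * W + 3).
  by apply: leq_mul; lia.
have h3 : d * (4 * q + 3) <= e * (8 * X + 3) by apply: leq_mul; lia.
have h4 : sw * (30 * q + 42).+1 <= X * (60 * X + 43) by apply: leq_mul; lia.
have hXW : X * X = W by rewrite /W; lia.
have hWZ : X * W = Z by rewrite /Z /W; lia.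
have f1 : X <= W by rewrite -hXW leq_pmulr.
have f2 : W <= Z by rewrite -hWZ leq_pmull.
have f3 : t * W <= t * Z by rewrite leq_mul.
have f4 : e * X <= e * Z by rewrite leq_mul //; lia.
have f5 : e <= e * Z by rewrite leq_pmulr //; lia.
have f6 : t <= t * Z by rewrite leq_pmulr //; lia.
have f7 : 0 < X by [].
have e1 : X * (e + 5) = e * X + 5 * X by rewrite mulnDr !(mulnC X).
have e2 : (2 * X + t) * (200 * W + 3) =
    400 * Z + 6 * X + 200 * (t * W) + 3 * t by rewrite -hWZ; ring.
have e3 : e * (8 * X + 3) = 8 * (e * X) + 3 * e by ring.
have e4 : X * (60 * X + 43) = 60 * W + 43 * X by rewrite -hXW; ring.
have -> : (1000 + 20 * e) * Z * t.+1 =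
    1000 * Z + 1000 * (t * Z) + 20 * (e * Z) + 20 * (e * Z * t) by ring.
rewrite e1 e2 e3 e4 in h1 h2 h3 h4; have hN : N < X by [].
move: (e * X) (t * W) (t * Z) (e * Z) f3 f4 f5 f6 h1 h2 h3 h4 => ? ? ? ?.
by clearbody X W Z; clear -hN f1 f2 f7 hsw hC hk hd hsv hq; lia.
Qed.

Section Decision.
Variables (M : turing_machine (option bool)) (phi psi : formula).

Local Notation S := (option fsymbol).
Local Notation w := (formula_pair phi psi).
Local Notation mem := (mem M).
Local Notation view := (view S M).
Local Notation prog := (prog S M).
Local Notation look := (look w).
Local Notation runs := (@runs S M w).

Definition start_walk : prog :=
  Seq (Step (bumps [:: cXq; cYp] [::]))
      (moves [:: (cFuel, [:: cRest; cTmp], [::]); (cTmp, [:: cFuel], [::])]).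

(** The fractions 0/1 and 1/0, which the quotient a_0 = 0 merely exchanges. *)
Definition walk0 : walk := Walk 0 1 1 0.

Lemma runs_start_walk N h k :
  runs start_walk (Mem (sim_ctr N 0 0 0 0) [::] h k)
    (Mem (walk_ctr N 0 (walk0, N)) [::] h k) (4 * N + 4).
Proof.
pose m1 := Mem (fun c => if c is cXq then 1 else if c is cYp then 1
  else sim_ctr N 0 0 0 0 c) [::] h k.
apply: (runs_seq m1 1 (4 * N + 3)); last by lia.
  apply: (runs_bumps (Mem _ [::] h k)).
  by apply/funext; case.
apply: (runs_moves m1 (walk_ctr N 0 (walk0, N))) => //=.
  by case; rewrite //= /moved /= /fuel /=; lia.
by rewrite /moved /=; lia.
Qed.

Definition compare : prog :=
  Seq (moves [:: (cStk, [:: cA; cB], [::])])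
 (Seq (pop M)
      (moves [:: (cStk, [:: cTmp], [:: cA]); (cB, [::], [:: cTmp])])).

(** [cA] and [cTmp] hold the two truncated differences of the values of the formulas. *)
Definition equal_test : view -> bool := fun v => vzero v cA && vzero v cTmp.

Lemma runs_compare p q g v u r h k : v <= q -> u <= q ->
  runs compare (Mem (eval_ctr p q g v 0 0 0) (u :: r) h k)
    (Mem (eval_ctr p q g 0 (v - u) 0 (u - v)) r h k) (10 * q + 10).
Proof.
move=> hv hu; pose m1 := Mem (eval_ctr p q g 0 v v 0) (u :: r) h k.
pose m2 := Mem (eval_ctr p q g u v v 0) r h k.
apply: (runs_seq m1 (2 * q + 2) (4 * q + 4)); last by lia.
  apply: (runs_moves (Mem _ _ h k) (ctr m1)) => //=; last by lia.
  by case; rewrite //= /moved /=; lia.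
apply: (runs_seq m2 1 (4 * q + 3)); last by lia.
  exact: runs_pop.
apply: (runs_moves m2 (eval_ctr p q g 0 (v - u) 0 (u - v))) => //=.
  by case; rewrite //= /moved /=; lia.
by rewrite /moved /=; lia.
Qed.

Definition decide (C a a' b b' : nat) : prog :=
  Seq (count_input S M C) (Seq (double_loop S M) (Seq (write_arg S M)
 (Seq (run_sim S M) (Seq start_walk (Seq (read_quotients S M)
 (Seq (close_walk M) (Seq (set_gen M a a' b b')
 (Seq (eval_input M) compare)))))))).

Lemma no_underflow_pair : no_underflow 0 w.
Proof.
rewrite no_underflow_formula /=.
by rewrite -[map Some (fstring psi)]cats0 no_underflow_formula.
Qed.

Lemma eval_pair q g : foldl (eval_symbol q g) (0, [::]) w =
  (chain_value q g psi, [:: chain_value q g phi; 0]).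
Proof. by rewrite foldl_cat eval_formula /= eval_formula. Qed.

Lemma wgood_read N v a : wgood N a.1 -> a.2 <= fuel N a.1 ->
  let a' := foldl (read_symbol N) a v in
  wgood N a'.1 /\ a'.2 <= fuel N a'.1.
Proof.
elim: v a => //= x v ih [s u] /= hs hu; apply: ih; case: x => [b|] //=.
- by apply: wgood_swap; apply: wgood_iter.
- by lia.
Qed.

Lemma runs_decide C a a' b b' v t :
  let N := C * size w in 0 < C ->
  tm_outputs M (unary (2 * (trunc_log 2 N).+1)) v t ->
  let s := (foldl (read_symbol N) (walk0, N) v).1 in
  let p := xp s + yp s in let q := xq s + yq s in
  let g := a * q + b * p - a' * q - b' * p in g <= q ->
  exists2 m,
    equal_test (look m) = (chain_value q g phi == chain_value q g psi) &
    runs (decide C a a' b b') (mem0 M) m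
      ((1000 + 20 * (C + a + a' + b + b')) * N.+1 ^ 3 * t.+1).
Proof.
move=> N hC hout s p q g hg; set k := (trunc_log 2 N).+1 in hout.
have hw : 0 < size w by rewrite /formula_pair size_cat addnS.
have hN : 0 < N by rewrite muln_gt0 hC.
have hwN : size w <= N by rewrite leq_pmull.
have hk : k <= N.
  have /andP[h _] := trunc_log_bounds (isT : 1 < 2) hN.
  by apply: leq_trans h; rewrite ltn_expl.
have hsz : size v <= 2 * k + t by have := size_output hout; rewrite size_nseq.
have [hs hu] : wgood N s /\ (foldl (read_symbol N) (walk0, N) v).2 <= fuel N s.
  by apply: wgood_read; rewrite /wgood /fuel /=; lia.
have hpq : p <= q.
  by move: hs; rewrite /p /q => /and5P[h1 h2 h3 h4 /andP[h5 h6]]; lia.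
have hq : q <= 2 * N + 1 by case/andP: hs.
have [c1 [hc1 hc1'] hrun] := runs_run_sim w N hout.
have hgood0 : wgood N (walk0, N).1 by rewrite /wgood /=; lia.
have hfuel0 : (walk0, N).2 <= fuel N (walk0, N).1 by rewrite /fuel /=; lia.
have [c2 hread] :=
  @runs_read_quotients S M w N v c1 (walk0, N) 0%R hgood0 hfuel0 hc1 hc1'.
pose m1 := Mem (count_ctr 0 N) [::] 0%R (tm_init M [::]).
pose m2 := Mem (double_ctr N 0 0 (2 * k)) [::] 0%R (tm_init M [::]).
pose m3 := Mem (sim_ctr N 0 0 0 0) [::] 0%R (tm_init M (unary (2 * k))).
pose m4 := Mem (sim_ctr N 0 0 0 0) [::] 0%R c1.
pose m5 := Mem (walk_ctr N 0 (walk0, N)) [::] 0%R c1.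
pose m6 := Mem (walk_ctr N 0 (foldl (read_symbol N) (walk0, N) v)) [::] 0%R c2.
pose m7 := Mem (eval_ctr p q 0 0 0 0 0) [::] 0%R c2.
pose m8 := Mem (eval_ctr p q g 0 0 0 0) [::] 0%R c2.
set x := chain_value q g phi; set y := chain_value q g psi.
pose m9 := Mem (eval_ctr p q g y 0 0 0) [:: x; 0] (Posz (size w)) c2.
exists (Mem (eval_ctr p q g 0 (y - x) 0 (x - y)) [:: 0] (Posz (size w)) c2).
  by rewrite /equal_test /=; lia.
have hm2 : m2 = Mem (sim_ctr N (2 * k) 0 0 0) [::] 0%R (tm_init M [::]).
  by congr Mem; apply/funext; case.
have hx : x <= q by apply: chain_value_le.
have hy : y <= q by apply: chain_value_le.
pose e := C + a + a' + b + b'.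
apply: (runs_seq m1 _ _ (runs_count_input M w C)).
  apply: (runs_seq m2 (100 * N.+1 ^ 2) _ _ _ (leqnn _)).
    exact: (runs_double_loop w (m := m1)).
  apply: (runs_seq m3 (4 * (2 * k) + 2) _ _ _ (leqnn _)).
    by rewrite hm2; apply: runs_write_arg.
  apply: (runs_seq m4 _ _ hrun _ (leqnn _)).
  apply: (runs_seq m5 _ _ (runs_start_walk _ _ _) _ (leqnn _)).
  apply: (runs_seq m6 _ _ hread _ (leqnn _)).
  apply: (runs_seq m7 (20 * N + 40) _ _ _ (leqnn _)).
    exact: (runs_close_walk w (m := m6) hs hu).
  apply: (runs_seq m8 _ _ _ _ (leqnn _)).
    exact: (runs_set_gen w a a' b b' (m := m7) hpq).
  apply: (runs_seq m9 (size w * (30 * q + 42).+1 + 1) _ _ _ (leqnn _)).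
    have := @runs_eval_input M w p q g c2 hg no_underflow_pair.
    by rewrite eval_pair.
  exact: runs_compare.
by apply: cost_bound => //; rewrite -/N; lia.
Qed.

End Decision.

(** * Correctness of the walk *)

Definition bits_value (v : nat) (bs : seq bool) : nat :=
  foldl (fun x b => 2 * x + nat_of_bool b) v bs.

Lemma bits_value_nat n : bits_value 0 (nat_bits n) = n.
Proof.
rewrite /nat_bits -{2}[n]bin_of_natK; case: (bin_of_nat n) => //= p.
by elim: p => //= p ih; rewrite /bits_value foldl_rcons -/(bits_value _ _) ih
  /= NatTrec.doubleE; lia.
Qed.

Definition block N a (s : walk) : walk :=
  wswap (iter (minn (fuel N s) a) (wstep N) s).

(** Appending a bit turns x into 2x + b, and fuel - (2x + b) = 2 (fuel - x) - fuel - b. Truncation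
    is harmless: once x reaches the fuel, both sides stay 0. *)
Lemma read_bits N s x bs :
  foldl (read_symbol N) (s, fuel N s - x) (map Some bs) =
  (s, fuel N s - bits_value x bs).
Proof.
elim: bs x => //= b bs ih x; rewrite -ih; congr (foldl _ (_, _) _); lia.
Qed.

Lemma read_binary_list N s l :
  foldl (read_symbol N) (s, fuel N s) (binary_list l) =
  (let s' := foldl (fun s a => block N a s) s l in (s', fuel N s')).
Proof.
rewrite /binary_list; elim: l s => //= a l ih s.
rewrite foldl_cat foldl_rcons -{1}[fuel N s]subn0 read_bits bits_value_nat /=.
rewrite (_ : fuel N s - (fuel N s - a) = minn (fuel N s) a); last by lia.
exact: ih.
Qed.

Lemma iter_wstep N n s : 0 < yq s -> exists2 i, i <= n &
  iter n (wstep N) s = Walk (xp s + i * yp s) (xq s + i * yq s) (yp s) (yq s) /\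
  (i = n \/ N < xq s + i * yq s + yq s).
Proof.
move=> hy; elim: n => [|n [i hin [hi hor]]].
  by exists 0 => //; rewrite !addn0; case: s {hy}; split; [|left].
rewrite iterS hi /wstep /= hy /=; case: leqP => hN; last first.
  by exists i; [lia | split => //; right].
exists i.+1; first by lia.
split; first by congr Walk; lia.
by left; case: hor; lia.
Qed.

Lemma block_steps N a s : 0 < yq s -> exists2 i, i <= a &
  block N a s = Walk (yp s) (yq s) (xp s + i * yp s) (xq s + i * yq s) /\
  (i = a \/ N < xq s + i * yq s + yq s).
Proof.
move=> hy; have [i hi [e ho]] := iter_wstep N (minn (fuel N s) a) hy.
exists i; first by lia.
split; first by rewrite /block e.
case: ho => h; last by right.
case: (ltnP a (fuel N s)) => hf; first by left; lia.
(* Here [i] is the whole fuel, and as many additions of [yq s >= 1] lead beyond N. *)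
by right; rewrite h /fuel (minn_idPl hf) /fuel; nia.
Qed.

Lemma block_stopped N a s : N < xq s + yq s -> block N a s = wswap s.
Proof.
by move=> h; rewrite /block (_ : fuel N s = 0) ?min0n // /fuel; lia.
Qed.

Local Open Scope ring_scope.

(** * Complete quotients of theta and the sign of m + n theta *)

Section Irrational.
Variables (R : realType).
Implicit Types theta : R.

Definition gauss (x : R) : R := (x - (Num.floor x)%:~R)^-1.

Lemma irrationalP (x : R) :
  irrational x <-> forall m n : int, n != 0 -> m%:~R + n%:~R * x != 0.
Proof.
split=> [hx m n hn|h [q _ hq]].
  apply/eqP => h; apply: hx; exists (- m%:~R / n%:~R) => //.
  rewrite fmorph_div rmorphN /= !ratr_int.
  have -> : - m%:~R = n%:~R * x by lra.
  by rewrite mulrC mulKf // intr_eq0.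
have := h (- numq q) (denq q) (denq_neq0 q).
rewrite -hq [ratr q]/(_ / _) mulrCA mulfV ?mulr1 ?intr_eq0 ?denq_neq0 //.
by rewrite rmorphN addNr eqxx.
Qed.

Lemma gauss_irrational (x : R) : irrational x ->
  [/\ irrational (gauss x), 0 < x - (Num.floor x)%:~R & 1 < gauss x].
Proof.
move=> /irrationalP hx; set f := Num.floor x.
have /andP[h1 h2] : f%:~R <= x < (f + 1)%:~R := floor_itv x.
have h0 : 0 < x - f%:~R.
  rewrite lt0r subr_ge0 h1 andbT.
  by have := hx (- f) 1 isT; rewrite mul1r rmorphN addrC.
split => //.
  apply/irrationalP => m n hn; rewrite /gauss -/f.
  apply/eqP => h; have : m%:~R * (x - f%:~R) + n%:~R = 0.
    have := congr1 (fun z => z * (x - f%:~R)) h.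
    by rewrite mul0r mulrDl mulfVK // gt_eqF.
  move=> h'; case: (eqVneq m 0) => [m0|m0].
    by move: h'; rewrite m0 mul0r add0r => /eqP; rewrite intr_eq0 (negPf hn).
  have /eqP := hx (n - m * f) m m0; apply.
  by rewrite rmorphB rmorphM /= -h'; ring.
by rewrite /gauss -/f invf_gt1 //; move: h2; rewrite rmorphD /=; lra.
Qed.

Lemma iter_gauss theta k : irrational theta -> irrational (iter k gauss theta).
Proof. by move=> h; elim: k => //= k /gauss_irrational[]. Qed.

(* That is, theta = (xp + b yp) / (xq + b yq). *)
Definition weighted theta (s : walk) (b : R) : Prop :=
  0 < b /\ theta * ((xq s)%:R + b * (yq s)%:R) = (xp s)%:R + b * (yp s)%:R.

Definition unimodular (s : walk) : Prop :=
  let d := ((xp s)%:Z * (yq s)%:Z - (yp s)%:Z * (xq s)%:Z)%R in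
  d = 1 \/ d = -1.

Lemma weighted_swap theta s b :
  weighted theta s b -> weighted theta (wswap s) b^-1.
Proof.
case=> hb h; split; first by rewrite invr_gt0.
have hb0 : b != 0 by rewrite gt_eqF.
rewrite /= (_ : _ + _ = b^-1 * ((xq s)%:R + b * (yq s)%:R)); last by field.
by rewrite mulrCA h; field.
Qed.

Lemma unimodular_swap s : unimodular s -> unimodular (wswap s).
Proof. by rewrite /unimodular /=; lia. Qed.

(* Either the walk has been stopped, or the weight is still the complete
   quotient of theta. *)
Definition walk_inv N theta k (s : walk) : Prop :=
  unimodular s /\
  ((N < xq s + yq s)%N /\ (exists b, weighted theta s b) \/
   [/\ (0 < yq s)%N, (xq s <= yq s)%N, (2 ^ k <= (xq s + yq s) ^ 2)%N &
       weighted theta s (iter k.+1 gauss theta)]).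

Lemma weighted_steps theta s b i : weighted theta s b -> i%:R < b ->
  weighted theta
    (Walk (xp s + i * yp s) (xq s + i * yq s) (yp s) (yq s)) (b - i%:R).
Proof.
case=> hb h hi; split; first by rewrite subr_gt0.
rewrite /= !natrD !natrM.
have -> : (xq s)%:R + i%:R * (yq s)%:R + (b - i%:R) * (yq s)%:R =
   (xq s)%:R + b * (yq s)%:R :> R by ring.
by rewrite h; ring.
Qed.

(** i additions followed by the exchange turn the weight b into (b - i)^-1. For i = a = floor b this
    is the Gauss map; if the walk stops earlier, i <= a < b still keeps the weight positive. *)
Lemma walk_inv_block N theta k s : irrational theta ->
  walk_inv N theta k s ->
  walk_inv N theta k.+1 (block N `|partial_quotient theta k.+1|%N s).
Proof.
move=> hirr [hu [[hN [b hb]]|[hy hxy hk hw]]].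
  rewrite block_stopped //; split; first exact: unimodular_swap.
  left; split; first by rewrite /= addnC.
  by exists b^-1; apply: weighted_swap.
set al := iter k.+1 gauss theta in hw.
have [_ _ hal1] := gauss_irrational (@iter_gauss theta k hirr).
have [_ hfr hal2] := gauss_irrational (@iter_gauss theta k.+1 hirr).
rewrite -/al in hfr hal2; rewrite -[gauss _]/al in hal1.
have ha : partial_quotient theta k.+1 = Num.floor al by [].
have hfl : 0 < Num.floor al by rewrite floor_gt0; lra.
set a := `|_|%N; have haE : (Num.floor al)%:~R = a%:R :> R.
  by rewrite /a ha -[in LHS](gtz0_abs hfl) -pmulrn.
have ha0 : (0 < a)%N by rewrite /a ha absz_gt0 gt_eqF.
have [i hi [-> ho]] := block_steps N a hy.
have hial : i%:R < al.
  apply: (@le_lt_trans _ _ (a%:R)); first by rewrite ler_nat.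
  by rewrite -haE; lra.
have hw' := weighted_swap (weighted_steps hw hial).
split; first by move: hu; rewrite /unimodular /=; lia.
case: ho => [ia|hN]; last first.
  left; split; first by rewrite /= addnC.
  by exists (al - i%:R)^-1.
right; split; rewrite /= ?ia.
- by lia.
- by nia.
(* As [xq <= yq] and a >= 1, the new sum is at least xq + 2 yq, and (xq + 2 yq)^2 >= 2 (xq +
   yq)^2. *)
- by rewrite expnS; nia.
- by move: hw'; rewrite ia -haE.
Qed.

Lemma walk_inv_quotients N theta n : irrational theta -> 0 <= theta <= 1 ->
  walk_inv N theta n
    (foldl (fun s a => block N a s) walk0 (partial_quotients theta n)).
Proof.
move=> hirr /andP[h0 h1].
have hf : Num.floor theta = 0.
  apply: floor_def; rewrite add0r h0 /= lt_neqAle h1 andbT.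
  have /irrationalP/(_ 1 (-1) isT) := hirr.
  by rewrite mulN1r subr_eq0 eq_sym.
rewrite /partial_quotients; elim: n => [|n ih].
  (* The block of a_0 = 0 leaves x = 1/0 and y = 0/1, for which theta has weight 1 / theta. *)
  rewrite /= /partial_quotient /= hf /block absz0 minn0 /=.
  split; first by left.
  have [_ hp _] := gauss_irrational hirr.
  right; split => //=; split; first by rewrite invr_gt0.
  move: hp; rewrite /gauss hf subr0 /= => hp.
  by rewrite mulr1 mulr0 add0r addr0 mulfV // gt_eqF.
rewrite -[n.+2]addn1 iotaD map_cat foldl_cat /= add0n.
exact: walk_inv_block.
Qed.

(** Put u = m xq + n xp and v = m yq + n yp. The left side asks for the sign of u + b v with b > 0,
    the right side for that of u + v. Unimodularity gives u yq - v xq = n or -n, which is too small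
    for u and v to have strictly opposite signs. *)
Lemma walk_sign N theta s (m n : int) :
  unimodular s -> (N < xq s + yq s)%N -> (exists b, weighted theta s b) ->
  (`|n| <= N)%N ->
  (m%:~R + n%:~R * theta <= 0) =
  (m * (xq s + yq s)%:Z + n * (xp s + yp s)%:Z <= 0).
Proof.
case: s => p q p' q'; rewrite /unimodular /weighted /= => hu hN [b [hb hw]] hn.
pose u := m * q%:Z + n * p%:Z; pose v := m * q'%:Z + n * p'%:Z.
have hD : 0 < q%:R + b * q'%:R :> R.
  have [q0|q0] := posnP q.
    by rewrite q0 add0r mulr_gt0 // ltr0n; lia.
  by rewrite ltr_wpDr ?ltr0n // mulr_ge0 ?ler0n // ltW.
have hE : (m%:~R + n%:~R * theta) * (q%:R + b * q'%:R) = u%:~R + b * v%:~R.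
  rewrite mulrDl -mulrA hw /u /v !rmorphD !rmorphM /= -!pmulrn; ring.
rewrite -(pmulr_lle0 _ hD) hE.
have -> : m * (q + q')%:Z + n * (p + p')%:Z = u + v.
  by rewrite /u /v !PoszD; ring.
have hdet : u * q'%:Z - v * q%:Z = n * (p%:Z * q'%:Z - p'%:Z * q%:Z).
  by rewrite /u /v; ring.
(* Strictly opposite signs would give |n| >= q + q' > N. *)
have hsame : (0 <= u /\ 0 <= v) \/ (u <= 0 /\ v <= 0).
  case: (lerP 0 u) => hu0; case: (lerP 0 v) => hv0;
    [by left | | | by right; lia].
  - case: (eqVneq u 0) => [->|hu1]; first by right; lia.
    exfalso; have h1 : q'%:Z <= u * q'%:Z by nia.
    have h2 : q%:Z <= - v * q%:Z by nia.
    by case: hu => hd; rewrite hd in hdet; lia.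
  - case: (eqVneq v 0) => [->|hv1]; first by right; lia.
    exfalso; have h1 : q'%:Z <= - u * q'%:Z by nia.
    have h2 : q%:Z <= v * q%:Z by nia.
    by case: hu => hd; rewrite hd in hdet; lia.
clear hdet hE; case: hsame => -[hu0 hv0].
  have [hu0' hv0'] : 0 <= u%:~R :> R /\ 0 <= v%:~R :> R by rewrite !ler0z.
  apply/idP/idP => h; last first.
    have [-> ->] : u = 0 /\ v = 0 by lia.
    by rewrite mulr0 addr0.
  have hbv : 0 <= b * v%:~R by rewrite mulr_ge0 // ltW.
  have hu1 : u%:~R <= 0 :> R by lra.
  have hv1 : v%:~R <= 0 :> R by rewrite -(pmulr_rle0 _ hb); lra.
  by rewrite !lerz0 in hu1 hv1; lia.
apply/idP/idP => _; first by lia.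
have [hu0' hv0'] : u%:~R <= 0 :> R /\ v%:~R <= 0 :> R by rewrite !lerz0.
have hbv : b * v%:~R <= 0 by rewrite pmulr_rle0.
by lra.
Qed.

End Irrational.

(** * Values in K_0 *)

Section ProjectionClass.
Variables (R : realType) (A : cstarAlgType R).

Lemma projmx_scalar (e : A) : e * e = e -> star e = e ->
  projmx (e%:M : 'M[A]_1).
Proof.
move=> he hs; split; first by rewrite -scalar_mxM he.
by apply/matrixP => i j; rewrite !mxE !ord1 /= !mulr1n hs.
Qed.

Lemma K0_eltE (e : A) (he : projmx (e%:M : 'M[A]_1)) :
  K0_elt e = grot_class (mvn_class (MProj he), 0).
Proof.
rewrite /K0_elt /K0_class; case: pselect => // he'.
by rewrite (Prop_irrelevance he' he).
Qed.

Lemma K0_elt_pos (e : A) : e * e = e -> star e = e -> K0_pos (K0_elt e).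
Proof.
by move=> he hs; exists 1%N, e%:M; split => //; apply: projmx_scalar.
Qed.

Lemma star_complement (e : A) : star e = e -> star (1 - e) = 1 - e.
Proof.
by move=> hs; apply: (addIr e); rewrite -{2}hs -starD !subrK star1.
Qed.

Lemma K0_elt_complement (e : A) : e * e = e -> star e = e ->
  K0_elt e + K0_elt (1 - e) = K0_unit A.
Proof.
move=> he hs; set f := 1 - e.
have hef : e * f = 0 by rewrite mulrBr mulr1 he subrr.
have hfe : f * e = 0 by rewrite mulrBl mul1r he subrr.
have hff : f * f = f by rewrite {1}/f mulrBl mul1r hef subr0.
have hfs : star f = f by apply: star_complement.
have pe := projmx_scalar he hs; have pf := projmx_scalar hff hfs.
have p1 := projmx_scalar (mulr1 (1 : A)) (star1 A).
rewrite /K0_unit (K0_eltE pe) (K0_eltE pf) (K0_eltE p1).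
transitivity (grot_class
  (mvn_class (dsum (MProj pe) (MProj pf)), 0 : mvn_monoid A)).
  rewrite -[LHS]/(grot_add _ _) grot_addE /= -[_ + _ in LHS]/(vadd _ _) vaddE.
  by rewrite addr0.
congr (grot_class (_, _)); apply/eqmodP/asboolP => /=.
(* The column v with entries e and f = 1 - e is a partial isometry: v v* = diag(e, f) and v* v = e +
   f = 1. *)
exists (col_mx e%:M f%:M) => /=.
have hadj : adjmx (col_mx (e%:M : 'M[A]_1) (f%:M : 'M[A]_1)) = row_mx e%:M f%:M.
  case: pe => _ pe; case: pf => _ pf.
  by rewrite /adjmx tr_col_mx map_row_mx -!/(adjmx _) pe pf.
rewrite hadj mul_col_row mul_row_col -!scalar_mxM he hff hef hfe; split.
  by rewrite !raddf0.
by rewrite -raddfD /= addrC subrK.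
Qed.

End ProjectionClass.

Section Value.
Variables (R : realType) (A : cstarAlgType R) (G : set R) (f : K0 A -> R).
Hypothesis hf : unital_ordered_iso G (fun x y => x <= y) 1 f.

Lemma iso_sub x y : f (x - y) = f x - f y.
Proof.
case: hf => hD _ _ _ _; apply: (addIr (f y)).
by rewrite -hD !subrK.
Qed.

Lemma iso0 : f 0 = 0.
Proof. by rewrite -[0](subrr (0 : K0 A)) iso_sub subrr. Qed.

Lemma iso_meet x y : f (K0_meet x y) = Num.min (f x) (f y).
Proof.
case: hf => _ _ _ hle _.
have [h1 h2 h3] : is_K0_meet x y (K0_meet x y).
  (* The order is transported from the reals and thus total: the smaller element is a meet, and
     [xget] does not return its default. *)
  apply: xgetPex; case: (lerP (f x) (f y)) => hxy; [exists x | exists y].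
    by split=> [||w //]; apply/hle.
  by split=> [||w //]; apply/hle => //; apply: ltW.
move/hle: h1 => h1; move/hle: h2 => h2.
apply/eqP; rewrite eq_le le_min h1 h2 /=.
case: (lerP (f x) (f y)) => hxy; apply/hle; apply: h3; apply/hle => //.
exact: ltW.
Qed.

(** The upper bound is positivity of the class of the complementary projection 1 - e. *)
Lemma iso_elt_itv (e : A) : e * e = e -> star e = e ->
  0 <= f (K0_elt e) <= 1.
Proof.
move=> he hs; case: hf => _ _ _ hle h1.
have hpos (x : K0 A) : K0_pos x -> 0 <= f x.
  by move=> hx; rewrite -iso0; apply/hle; rewrite /K0_le subr0.
rewrite hpos /=; last exact: K0_elt_pos.
rewrite -[X in _ <= X]h1 -subr_ge0 -iso_sub -(K0_elt_complement he hs).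
rewrite [K0_elt e + _]addrC addrK hpos //.
exists 1%N, (1 - e)%:M; split => //; apply: projmx_scalar.
  by rewrite mulrBl mul1r mulrBr mulr1 he subrr subr0.
exact: star_complement.
Qed.

Variables (theta : R) (N : nat) (s : walk).
Hypotheses (hu : unimodular s) (hN : (N < xq s + yq s)%N)
  (hw : exists b, weighted theta s b).
Variables (g : K0 A) (a b : int).
Hypothesis hg : f g = a%:~R + b%:~R * theta.

Local Notation p := (xp s + yp s)%N.
Local Notation q := (xq s + yq s)%N.

(* Replacing theta by p / q preserves the value of every formula that is short
   enough for the coefficient of theta to be at most N. *)
Lemma coded_value (c gq : nat) phi :
  (`|b| <= c)%N -> (0 < c)%N ->
  gq%:Z = a * q%:Z + b * p%:Z -> (gq <= q)%N ->
  (c * flength phi <= N)%N ->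
  exists m n : int, [/\ f (coded g phi) = m%:~R + n%:~R * theta,
    (chain_value q gq phi)%:Z = m * q%:Z + n * p%:Z &
    (`|n| <= c * flength phi)%N].
Proof.
move=> hb hc hgq hgle; case: hf => hD _ _ _ h1.
elim: phi => [||phi ih|phi ihp psi ihq]; rewrite /flength /= => hlen.
- by exists 0, 0; split; rewrite ?iso0 ?mul0r ?addr0.
- by exists a, b; split => //; rewrite muln1.
- rewrite size_rcons in hlen *; have [|m [n [e1 e2 e3]]] := ih.
    by rewrite /flength; lia.
  have hle := chain_value_le phi hgle.
  exists (1 - m), (- n); split.
  + rewrite /elliott_star iso_sub h1 e1 !(rmorphB, rmorphN) /=; ring.
  + by rewrite -subzn // e2; ring.
  + by rewrite abszN; apply: leq_trans e3 _; rewrite leq_mul2l leqnSn orbT.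
- rewrite /= size_cat /= size_rcons in hlen *.
  have [|m [n [e1 e2 e3]]] := ihp; first by rewrite /flength; nia.
  have [|m' [n' [e1' e2' e3']]] := ihq; first by rewrite /flength; nia.
  have hn : (`|(n + n')%R| <=
      c * (size (fstring phi) + (size (fstring psi)).+2).+1)%N.
    by rewrite /flength in e3 e3'; nia.
  (* Whether the sum is cut off at the unit depends on the sign of (m + m' - 1) + (n + n') theta,
     which is the same in the chain. *)
  have hsgn := walk_sign (m + m' - 1) hu hN hw (leq_trans hn hlen).
  rewrite /elliott_oplus iso_meet hD h1 e1 e1'.
  have hsum : (chain_value q gq phi + chain_value q gq psi)%:Z =
      (m + m') * q%:Z + (n + n') * p%:Z by rewrite PoszD e2 e2'; ring.
  have hsum' : m%:~R + n%:~R * theta + (m'%:~R + n'%:~R * theta) =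
     (m + m')%:~R + (n + n')%:~R * theta by rewrite !rmorphD /=; ring.
  case: lerP => hle.
    exists (m + m'), (n + n'); split => //.
    rewrite -hsum; congr Posz.
    suff : (chain_value q gq phi + chain_value q gq psi <= q)%N by lia.
    rewrite -lez_nat hsum; move: hsgn; rewrite rmorphB /=.
    have -> : (m + m')%:~R - 1 + (n + n')%:~R * theta <= 0.
      by rewrite hsum' in hle; lra.
    move=> /esym; lia.
  exists 1, 0; split; rewrite ?mul0r ?addr0 ?mul1r //.
  congr Posz.
  suff : (q <= chain_value q gq phi + chain_value q gq psi)%N by lia.
  rewrite -lez_nat hsum; move: hsgn; rewrite rmorphB /=.
  have -> : ((m + m')%:~R - 1 + (n + n')%:~R * theta <= 0) = false.
    by apply/negbTE; rewrite -ltNge; rewrite hsum' in hle; lra.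
  move=> /esym; lia.
Qed.

End Value.

(** Two applications of [walk_sign], to (m, n) and (-m, -n). *)
Lemma walk_eq0 (R : realType) N (theta : R) s (m n : int) :
  unimodular s -> (N < xq s + yq s)%N -> (exists b, weighted theta s b) ->
  (`|n| <= N)%N ->
  (m%:~R + n%:~R * theta == 0) =
  (m * (xq s + yq s)%:Z + n * (xp s + yp s)%:Z == 0).
Proof.
move=> hu hN hw hn; have h1 := walk_sign m hu hN hw hn.
have := walk_sign (- m) hu hN hw (_ : (`|(- n)%R| <= N)%N).
rewrite abszN => /(_ hn).
rewrite !mulNr -opprD oppr_le0 !rmorphN /= mulNr -opprD.
by rewrite oppr_le0 => h2; rewrite !eq_le h1 h2.
Qed.

Lemma int_diff (z : int) : exists m n : nat, z = m%:Z - n%:Z.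
Proof. by case: z => n; [exists n, 0%N | exists 0%N, n.+1]; lia. Qed.

(** With k as in the proof, 2^k <= 2N, so that 2^(2 k kappa) <= (2^k)^(2K) <= (2N)^(2K). *)
Lemma simulation_time (R : realType) (kappa : R) (K N t : nat) :
  kappa <= K%:R -> (0 < N)%N ->
  t%:R < 2 `^ (kappa * (2 * (trunc_log 2 N).+1)%:R) ->
  (t <= (2 * N) ^ (2 * K))%N.
Proof.
move=> hK hN ht; set k := (trunc_log 2 N).+1 in ht.
have hk : (2 ^ k <= 2 * N)%N.
  by rewrite expnS leq_pmul2l // trunc_logP.
rewrite -(ler_nat R); apply: ltW; apply: (lt_le_trans ht).
apply: (@le_trans _ _ (2 `^ (K * (2 * k))%:R)).
  by apply: ler_powR; rewrite ?ler1n // [leRHS]natrM ler_wpM2r.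
rewrite powR_mulrn // -natrX ler_nat mulnCA mulnA mulnC expnM.
by case: (2 * K)%N => // K'; rewrite leq_exp2r.
Qed.

Unset Implicit Arguments.
Local Open Scope classical_set_scope.
Local Open Scope ring_scope.

Theorem theorem7p4 (R : realType) (theta : I01 R)
  (M1 : cstarAlgType R) (iota : K0 M1 -> I01 R -> R) (p : M1) (J : set M1)
  (F : cstarAlgType R) (rho : {lrmorphism M1 -> F}) :
  irrational (\val theta) ->
  farey_algebra iota ->
  p * p = p -> star p = p -> elliott_generator (K0_elt p) ->
  closed_ideal J -> K0_ideal J = [set x | iota x theta = 0] ->
  effros_shen_algebra theta F -> quotient_map J rho ->
  (exists kappa : R, 0 < kappa /\
     exists M : turing_machine (option bool),
       forall n : nat, exists t : nat,
         tm_outputs M (unary n)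
           (binary_list (partial_quotients (\val theta) n)) t /\
         ((0 < n)%N -> t%:R < 2 `^ (kappa * n%:R))) ->
  exists (T : {poly int}) (M : turing_machine (option fsymbol)),
    forall phi psi : formula, exists t : nat,
      tm_answers M (formula_pair phi psi)
        (coded (K0_elt (rho p)) phi = coded (K0_elt (rho p)) psi) t /\
      t%:Z < T.[(flength phi + flength psi)%:Z].
Proof.
move=> hirr _ hpp hps _ _ _ [_ [f hf]] [hstar _ _] [kappa [_ [M hM]]].
set g := K0_elt (rho p).
have hth : 0 <= \val theta <= 1.
  by have := set_mem (valP theta); rewrite /I01 /= in_itv.
have [hD hinj hrange hle h1] := hf.
have /andP[hg0 hg1] : 0 <= f g <= 1.
  by apply: (iso_elt_itv hf); rewrite -?rmorphM ?hpp // -hstar hps.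
have [a [b hg]] : exists a b : int, f g = a%:~R + b%:~R * \val theta.
  by have : range f (f g) by [exists g]; rewrite hrange.
have [ap [am ha]] := int_diff a; have [bp [bm hb]] := int_diff b.
pose c := (`|b|%N).+1; pose K := Num.bound `|kappa|.
have hK : kappa <= K%:R.
  by apply: (le_trans (ler_norm _)); apply/ltW/archi_boundP.
pose e := (1000 + 20 * (c + ap + am + bp + bm))%N.
pose Np : {poly int} := c%:R *: ('X + 1).
(* [Np] evaluates to N, the 1 in it being the separator between the formulas. The bound is that of
   [runs_decide] with (2N)^(2K) for the time of [M]; the 3 pays for the first and last steps of the
   machine and for strictness. *)
exists (e%:R *: ((Np + 1) ^+ 3 * ((2 *: Np) ^+ (2 * K) + 1)) + 3%:P).
exists (machine (decide M c ap am bp bm) (@equal_test M)).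
move=> phi psi; set w := formula_pair phi psi; set N := (c * size w)%N.
have hsize : size w = (flength phi + flength psi).+1.
  by rewrite /w /formula_pair size_cat /= !size_map addnS.
have hN : (0 < N)%N by rewrite /N hsize.
(* The argument is positive, as the time bound on [M] requires. *)
have [t [hout /(_ isT) ht]] := hM (2 * (trunc_log 2 N).+1)%N.
have {}ht := simulation_time hK hN ht.
have hinv := @walk_inv_quotients R N _ (2 * (trunc_log 2 N).+1) hirr hth.
set s := foldl _ _ _ in hinv.
have hs : (foldl (read_symbol N) (walk0, N)
    (binary_list (partial_quotients (\val theta)
                   (2 * (trunc_log 2 N).+1)))).1 = s.
  have hN0 : fuel N walk0 = N by rewrite /fuel /=; lia.
  by rewrite -[(walk0, N)]/(walk0, id N) -{2}hN0 read_binary_list.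
have [hu [hq hw]] : unimodular s /\ (N < xq s + yq s)%N /\
    exists b, weighted (\val theta) s b.
  case: hinv => hu [[h h']|[h h' h2 h3]]; split=> //; split=> //; last first.
    by eexists; exact: h3.
  (* If the walk was never stopped, 2^(2k) <= (xq + yq)^2, whence N < 2^k <= xq + yq. *)
  have : (2 ^ (trunc_log 2 N).+1 <= xq s + yq s)%N.
    by rewrite mulnC expnM leq_exp2r in h2.
  by apply: leq_trans; rewrite trunc_log_ltn.
set P := (xp s + yp s)%N; set Q := (xq s + yq s)%N.
have hbN : (`|b| <= N)%N.
  by rewrite /N hsize (leq_trans (leqnSn _)) // leq_pmulr.
(* [walk_sign] carries 0 <= f g <= 1 over to the chain, so that the truncated subtractions in [gq]
   are exact. *)
have hge0 : 0 <= a * Q%:Z + b * P%:Z.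
  have := walk_sign (- a) hu hq hw (_ : (`|(- b)%R| <= N)%N).
  rewrite abszN => /(_ hbN); rewrite !rmorphN /= -/P -/Q => h.
  have : - a%:~R + - b%:~R * \val theta <= 0 by lra.
  by rewrite h; lia.
have hle1 : a * Q%:Z + b * P%:Z <= Q%:Z.
  have := walk_sign (a - 1) hu hq hw hbN; rewrite rmorphB /= -/P -/Q => h.
  have : a%:~R - 1 + b%:~R * \val theta <= 0 by lra.
  by rewrite h; lia.
pose gq := (ap * Q + bp * P - am * Q - bm * P)%N.
have hgq : gq%:Z = a * Q%:Z + b * P%:Z.
  by rewrite /gq ha hb in hge0 *; lia.
have hgQ : (gq <= Q)%N by lia.
have := @runs_decide M phi psi c ap am bp bm _ t isT hout.
rewrite -/N hs -/P -/Q -/gq => /(_ hgQ) [m hm [t' ht' hexec]].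
have hans := machine_answers (@equal_test M) hexec.
exists t'.+2; split.
  case: hans => hh hacc; split => //; rewrite hacc hm.
  have hlen phi' : (flength phi' <= flength phi + flength psi)%N ->
      (c * flength phi' <= N)%N.
    by move=> h; rewrite /N hsize leq_mul // leqW.
  have hbc : (`|b| <= c)%N by rewrite /c.
  have hval := coded_value hf hu hq hw hg hbc isT hgq hgQ.
  have [m1 [n1 [e1 e1' e1'']]] := hval phi (hlen phi (leq_addr _ _)).
  have [m2 [n2 [e2 e2' e2'']]] := hval psi (hlen psi (leq_addl _ _)).
  (* Equality is tested on the difference of the two values; this is why N involves the total length
     of both formulas. *)
  have hn : (`|(n1 - n2)%R| <= N)%N.
    have := leq_add e1'' e2''; rewrite -mulnDr => h.
    rewrite /N hsize mulnS; apply: leq_trans (leq_addl _ _).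
    by apply: leq_trans h; clear; lia.
  have heq := walk_eq0 (m1 - m2) hu hq hw hn.
  have -> : (coded g phi = coded g psi) <->
      f (coded g phi) - f (coded g psi) == 0.
    by rewrite subr_eq0; split=> [->//|/eqP/hinj].
  have -> : f (coded g phi) - f (coded g psi) =
      (m1 - m2)%:~R + (n1 - n2)%:~R * \val theta.
    by rewrite e1 e2 !rmorphB /=; ring.
  rewrite heq -/P -/Q.
  have -> : (m1 - m2) * Q%:Z + (n1 - n2) * P%:Z =
     (chain_value Q gq phi)%:Z - (chain_value Q gq psi)%:Z.
    by rewrite e1' e2' -/P -/Q; ring.
  by rewrite subr_eq0.
have hNp : Np.[(flength phi + flength psi)%:Z] = N%:Z.
  by rewrite /Np hornerZ hornerD hornerX hornerC /N hsize -addn1 PoszM natz.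
clearbody Np.
rewrite hornerD hornerZ hornerM hornerD !horner_exp hornerD !hornerC hornerZ.
rewrite hNp.
have hcast (e0 n0 : nat) :
    e0%:R * ((n0%:Z + 1) ^+ 3 * ((2 * n0%:Z) ^+ (2 * K) + 1)) + 3 =
    (e0 * (n0.+1 ^ 3 * ((2 * n0) ^ (2 * K) + 1)) + 3)%N%:Z.
  by rewrite -!natz !(natrD, natrM, natrX) -[n0.+1]addn1 natrD.
rewrite hcast ltz_nat mulnA addn3 !ltnS; apply: (leq_trans ht').
by rewrite leq_mul2l addn1 ltnS ht orbT.
Qed.
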